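(* There is a universal constant $A>0$ such that for every $f:\mathbb{H}\to L_2$ and every positive integer $R$ we have $$\sum_{x\in B_R}\sum_{k=1}^{R^2}\frac{\left\|f(xc^k)-f(x)\right\|_2^2}{k^2}\le A\sum_{x\in B_{22R}}\left(\|f(xa)-f(x)\|_2^2+\|f(xb)-f(x)\|_2^2\right).$$
   Context: $\mathbb{H}=\langle a,b \mid aba^{-1}b^{-1}\text{ is central}\rangle$ is the discrete Heisenberg group with identity $e$, $c=[a,b]=aba^{-1}b^{-1}$, and $d_W$ is the left-invariant word metric on $\mathbb{H}$ associated to the symmetric generating set $S=\{a,b,a^{-1},b^{-1}\}$. For $r\ge1$, $B_r=\{x\in\mathbb{H}: d_W(e,x)\le r\}$. $L_2$ is Hilbert space with norm $\|\cdot\|_2$. *)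

(* Defs.v *)
From HB Require Import structures.
From mathcomp Require Import all_boot all_order all_algebra.
From mathcomp Require Import all_classical all_reals all_analysis.

Set Implicit Arguments.
Unset Strict Implicit.
Unset Printing Implicit Defensive.

Local Open Scope classical_set_scope.
Local Open Scope quotient_scope.
Local Open Scope group_scope.

(* A letter is a pair (generator, inverted?): (false, _) stands for a^{+-1},
   (true, _) for b^{+-1}; the second component is true for the inverse. *)
Definition letter := (bool * bool)%type.
Definition linv (l : letter) : letter := (l.1, ~~ l.2).
Definition word := seq letter.
Definition winv (w : word) : word := rev (map linv w).

Definition la : letter := (false, false).
Definition lb : letter := (true, false).
Definition wcomm : word := [:: la; lb; linv la; linv lb].

(* Equality in the group < a, b | a b a^-1 b^-1 is central >: the smallest
   congruence on words that cancels inverse letters and makes a b a^-1 b^-1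
   commute with everything. *)
Inductive heis_eq : word -> word -> Prop :=
| heis_refl w : heis_eq w w
| heis_sym u v : heis_eq u v -> heis_eq v u
| heis_trans u v w : heis_eq u v -> heis_eq v w -> heis_eq u w
| heis_cat u u' v v' :
    heis_eq u u' -> heis_eq v v' -> heis_eq (u ++ v) (u' ++ v')
| heis_cancel l : heis_eq [:: l; linv l] [::]
| heis_central w : heis_eq (wcomm ++ w) (w ++ wcomm).

Definition heis_eqb (u v : word) : bool := `[< heis_eq u v >].

Lemma heis_eqb_equiv : equiv_class_of heis_eqb.
Proof.
split.
- by move=> w; apply/asboolP; exact: heis_refl.
- by move=> u v; apply/asboolP/asboolP; exact: heis_sym.
- by move=> v u w /asboolP uv /asboolP vw; apply/asboolP; exact: heis_trans vw.
Qed.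

Canonical heis_equiv := EquivRelPack heis_eqb_equiv.

Definition heis := {eq_quot heis_eqb}.
HB.instance Definition _ := Choice.on heis.
HB.instance Definition _ := EqQuotient.on heis.

Definition heis_one : heis := \pi_heis [::].
Definition heis_mul (x y : heis) : heis := \pi_heis (repr x ++ repr y).
Definition heis_inv (x : heis) : heis := \pi_heis (winv (repr x)).

Lemma heis_piP (u v : word) : \pi_heis u = \pi_heis v <-> heis_eq u v.
Proof.
split; first by move=> /eqP; rewrite eqmodE => /asboolP.
by move=> uv; apply/eqP; rewrite eqmodE; apply/asboolP.
Qed.

Lemma heis_repr (w : word) : heis_eq (repr (\pi_heis w)) w.
Proof. by apply/heis_piP; rewrite reprK. Qed.

Lemma heisW (P : heis -> Prop) :
  (forall w : word, P (\pi_heis w)) -> forall x, P x.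
Proof. by move=> Pw x; rewrite -(reprK x). Qed.

Lemma heis_mulE (u v : word) : heis_mul (\pi_heis u) (\pi_heis v) = \pi_heis (u ++ v).
Proof. by apply/heis_piP; apply: heis_cat; exact: heis_repr. Qed.

Lemma winvK : involutive winv.
Proof.
move=> w; rewrite /winv map_rev revK -map_comp; apply: map_id_in => -[i e] _.
by rewrite /= /linv /= negbK.
Qed.

Lemma winv_cat (u v : word) : winv (u ++ v) = winv v ++ winv u.
Proof. by rewrite /winv map_cat rev_cat. Qed.

Lemma heis_catV (w : word) : heis_eq (w ++ winv w) [::].
Proof.
elim: w => [|l w IH]; first exact: heis_refl.
have -> : (l :: w) ++ winv (l :: w) = [:: l] ++ ((w ++ winv w) ++ [:: linv l]).
  by rewrite -cat1s winv_cat !catA.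
apply: heis_trans (heis_cancel l).
apply: (heis_cat (heis_refl [:: l])).
exact: (heis_cat IH (heis_refl [:: linv l])).
Qed.

Lemma heis_Vcat (w : word) : heis_eq (winv w ++ w) [::].
Proof. by rewrite -{2}(winvK w); exact: heis_catV. Qed.

Lemma heis_mulA : associative heis_mul.
Proof.
elim/heisW=> u; elim/heisW=> v; elim/heisW=> w.
by rewrite (heis_mulE v) (heis_mulE u v) heis_mulE (heis_mulE (u ++ v)) catA.
Qed.

Lemma heis_mul1g : left_id heis_one heis_mul.
Proof. by elim/heisW=> w; rewrite (heis_mulE _ w). Qed.

Lemma heis_mulg1 : right_id heis_one heis_mul.
Proof. by elim/heisW=> w; rewrite (heis_mulE w) cats0. Qed.

Lemma heis_mulVg : left_inverse heis_one heis_inv heis_mul.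
Proof.
move=> x; rewrite -{2}(reprK x) heis_mulE; apply/heis_piP; exact: heis_Vcat.
Qed.

Lemma heis_mulgV : right_inverse heis_one heis_inv heis_mul.
Proof.
move=> x; rewrite -{1}(reprK x) heis_mulE; apply/heis_piP; exact: heis_catV.
Qed.

HB.instance Definition _ := isGroup.Build heis
  heis_mulA heis_mul1g heis_mulg1 heis_mulVg heis_mulgV.

Definition ha : heis := \pi_heis [:: la].
Definition hb : heis := \pi_heis [:: lb].
(* Not MathComp's [~ ha, hb], which is a^-1 b^-1 a b. *)
Definition hc : heis := ha * hb * ha^-1 * hb^-1.

Definition heis_gens : seq heis := [:: ha; hb; ha^-1; hb^-1].

Definition heis_prod (w : seq heis) : heis := \prod_(x <- w) x.

Definition expressible (x : heis) (n : nat) : bool :=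
  `[< exists w : n.-tuple heis,
        {subset w <= heis_gens} /\ heis_prod w = x >].

Lemma hletter (l : letter) : \pi_heis [:: l] \in heis_gens.
Proof.
have haV : ha^-1 = \pi_heis [:: linv la].
  rewrite -[RHS]mulg1 -(mulgV ha) mulgA; apply/esym.
  by rewrite [X in X * _]heis_mulE (heis_piP _ [::]).2 ?mul1g//; exact: heis_cancel.
have hbV : hb^-1 = \pi_heis [:: linv lb].
  rewrite -[RHS]mulg1 -(mulgV hb) mulgA; apply/esym.
  by rewrite [X in X * _]heis_mulE (heis_piP _ [::]).2 ?mul1g//; exact: heis_cancel.
rewrite /heis_gens haV hbV !inE.
by case: l => -[] []; rewrite eqxx ?orbT.
Qed.

Lemma heis_prod_word (w : word) :
  heis_prod [seq \pi_heis [:: l] | l <- w] = \pi_heis w.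
Proof.
rewrite /heis_prod; elim: w => [|l w IH]; first by rewrite big_nil.
by rewrite /= big_cons IH; exact: (heis_mulE [:: l] w).
Qed.

Lemma expressible_ex (x : heis) : exists n, expressible x n.
Proof.
exists (size (repr x)); apply/asboolP.
exists (map_tuple (fun l => \pi_heis [:: l]) (in_tuple (repr x))); split.
  by move=> y /mapP[l _ ->]; exact: hletter.
by rewrite /= heis_prod_word reprK.
Qed.

Definition dW (x y : heis) : nat := ex_minn (expressible_ex (x^-1 * y)).

Definition heis_ball (r : nat) : set heis := [set x | (dW 1%g x <= r)%N].

Lemma finite_heis_ball (r : nat) : finite_set (heis_ball r).
Proof.
pose S n := [set heis_prod [seq nth 1 heis_gens (val i) | i <- tval t]
            | t in [set: n.-tuple 'I_4]].
apply: (@sub_finite_set _ _ (\bigcup_(n in `I_r.+1) S n)); last first.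
  by apply: bigcup_finite => // n _; exact: finite_image.
move=> x /=; rewrite /heis_ball /dW /=; case: ex_minnP => n + _ nr.
rewrite invg1 mul1g => /asboolP[w [wS <-]].
exists n => //=.
exists (map_tuple (fun y => inord (index y heis_gens)) w) => //=.
rewrite -map_comp map_id_in// => y /wS yS /=.
have lty : (index y heis_gens < 4)%N by rewrite -index_mem in yS.
by rewrite inordK ?nth_index.
Qed.

(* Main.v *)
Require Import Defs.
From HB Require Import structures.
From mathcomp Require Import all_boot all_order all_algebra finmap.
From mathcomp Require Import all_classical all_reals all_analysis.
From mathcomp Require Import ring lra zify.

Set Implicit Arguments.
Unset Strict Implicit.
Unset Printing Implicit Defensive.

Import Order.TTheory GRing.Theory Num.Theory.
Import numFieldNormedType.Exports.

Local Open Scope classical_set_scope.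
Local Open Scope ring_scope.

(** The inequality is first proved for finitely supported functions on the
    whole group, and then localized.

    Globally, let A, B, C be the right translations by [ha], [hb], [hc] on
    finitely supported functions u : H -> V with the l^2 inner product.  They
    are isometries, C commutes with A and B, and AB = CBA.  The weights 1/k^2
    are dominated by w_k = 1/(k^2 - 1/4) = 1/(k - 1/2) - 1/(k + 1/2), whose sum
    over k >= 1 is 2, so that sum_k |C^k u - u|^2 / k^2 is at most Q(u), the
    quadratic form of W = sum_k w_k (2 - C^k - C^-k).  The choice of w_k makes
    W factor as a product of 1 - C with the discrete Hilbert transform
    S = sum_j C^j / (j + 1/2), which is a bounded operator because
      1 / ((i + 1/2)(j + 1/2)) = (1/(j + 1/2) - 1/(i + 1/2)) / (i - j)
    makes the off-diagonal terms of S* S cancel (lemma [toeplitz_hker_le]; only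
    truncations of S to 2M terms are used, M being large compared with the
    support of u).  Now
      (1 - C)BA = BA - AB = (B - 1)(A - 1) - (A - 1)(B - 1),
    and S commutes with A and B, so moving one difference operator to the other
    side of the inner product bounds <W BAu, u> by a multiple of
    |Au - u|^2 + |Bu - u|^2.  Since Q is invariant under the isometry BA,
      Q(u) = <W BAu, u> + Q(BAu - u) / 2,
    and Q(BAu - u) is at most a multiple of |BAu - u|^2.  This gives
    [commutator_energy_le], and then [sum_translate_hc_le].

    To localize, fix y in the ball of radius 10r and apply the global
    inequality to u(x) = m(x)(f(x) - f(y)), where the cutoff m equals r on the
    ball of radius 9r, vanishes outside the ball of radius 10r and is
    1-Lipschitz.  The points x hc^k with |x| <= r and k <= r^2 have length at
    most 7r, since hc^(mn) is the commutator of ha^m and hb^n.  The gradient of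
    m costs a multiple of sum_x |f(x) - f(y)|^2; averaged over y, it is
    controlled by the Poincare inequality on the ball of radius 10r
    ([poincare], by summing along words of length at most 20r, which stay in
    the ball of radius 20r), together with the doubling property of balls
    ([card_hball_doubling]). *)

(** * The truncated discrete Hilbert transform *)

Section HilbertKernel.
Variable R : realFieldType.

(** The kernel 1/(j + 1/2) at j = i - M: windows of integers centred at 0 are
    indexed by the natural numbers below 2M. *)
Definition hker (M i : nat) : R := (i%:R - M%:R + 2^-1)^-1.

Lemma hker_den_neq0 (M i : nat) : i%:R - M%:R + 2^-1 != 0 :> R.
Proof.
apply/eqP => h; have : (i.*2.+1)%:R = (M.*2)%:R :> R.
  rewrite -addn1 natrD -!muln2 !natrM; lra.
by move/eqP; rewrite eqr_nat => /eqP; lia.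
Qed.

(** The partial fraction identity that makes the Hilbert transform bounded: the
    denominator depends on i - j only, and the numerator separates i from j. *)
Lemma hker_mul (M i j : nat) : i != j ->
  hker M i * hker M j = (hker M j - hker M i) / (i%:R - j%:R).
Proof.
move=> ij; move: (ij); rewrite -(eqr_nat R) -subr_eq0 => dij.
have -> : i%:R - j%:R = (i%:R - M%:R + 2^-1) - (j%:R - M%:R + 2^-1) :> R by ring.
have {}dij : (i%:R - M%:R + 2^-1) - (j%:R - M%:R + 2^-1) != 0 :> R.
  by rewrite opprD addrACA subrr addr0 opprB addrA addrNK.
rewrite /hker; move: (hker_den_neq0 M i) (hker_den_neq0 M j) dij.
move: (i%:R - M%:R + 2^-1) (j%:R - M%:R + 2^-1) => x y x0 y0 xy.
by field; rewrite xy x0 y0.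
Qed.

Lemma hker_rev (M i : nat) : (i < M.*2)%N -> hker M (M.*2 - i.+1) = - hker M i.
Proof.
move=> iM; rewrite /hker -invrN; congr (_^-1).
rewrite natrB // -addnn natrD -natr1; lra.
Qed.

Lemma sum_hker (M : nat) : \sum_(i < M.*2) hker M i = 0.
Proof.
have : \sum_(i < M.*2) hker M i = - \sum_(i < M.*2) hker M i.
  rewrite [LHS](reindex_inj rev_ord_inj) /= -sumrN.
  by apply: eq_bigr => i _; rewrite hker_rev.
lra.
Qed.

(** Comparison of 1/(i + 1/2)^2 with the telescoping 1/(i(i+1)) for i > 0; the
    term i = 0 is 4. *)
Lemma sum_hker_sqr_half (n : nat) :
  \sum_(i < n) (i%:R + 2^-1 : R)^-1 ^+ 2 <= 5.
Proof.
case: n => [|n]; first by rewrite big_ord0; lra.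
suff H : \sum_(i < n.+1) (i%:R + 2^-1 : R)^-1 ^+ 2 <= 5 - n.+1%:R^-1.
  by apply: le_trans H _; rewrite lerBlDr lerDl invr_ge0.
elim: n => [|n IH]; first by rewrite big_ord_recr big_ord0 /= !add0r invrK invr1; lra.
rewrite big_ord_recr /=.
have n0 : 0 < n.+1%:R :> R by rewrite ltr0n.
have : (n.+1%:R + 2^-1 : R)^-1 ^+ 2 <= n.+1%:R^-1 - n.+2%:R^-1.
  rewrite -[n.+2%:R]natr1; move: (n.+1%:R) n0 => x n0 {IH}.
  have x1 : 0 < x + 1 by lra.
  have -> : x^-1 - (x + 1)^-1 = (x * (x + 1))^-1.
    by field; rewrite !gt_eqF.
  rewrite exprVn lef_pV2 ?posrE ?mulr_gt0 ?exprn_gt0 //; first nra; lra.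
by move=> h; apply: le_trans (lerD IH h) _; rewrite addrA subrK.
Qed.

Lemma sum_hker_sqr (M : nat) : \sum_(i < M.*2) hker M i ^+ 2 <= 10.
Proof.
have -> : \sum_(i < M.*2) hker M i ^+ 2 = \sum_(0 <= i < M.*2) hker M i ^+ 2.
  by rewrite big_mkord.
rewrite (@big_cat_nat _ _ _ M) //=; last by rewrite -addnn leq_addr.
have half : \sum_(M <= i < M.*2) hker M i ^+ 2 <= 5.
  rewrite -{1}[M]add0n big_addn -addnn addnK big_mkord.
  rewrite (eq_bigr (fun i : 'I_M => (i%:R + 2^-1 : R)^-1 ^+ 2)); first exact: sum_hker_sqr_half.
  by move=> i _; rewrite /hker natrD addrK.
have half' : \sum_(0 <= i < M) hker M i ^+ 2 <= 5.
  rewrite big_nat_rev /= add0n big_mkord.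
  rewrite (eq_bigr (fun i : 'I_M => (i%:R + 2^-1 : R)^-1 ^+ 2)); first exact: sum_hker_sqr_half.
  move=> i _; rewrite /hker natrB // -natr1 -sqrrN -invrN.
  by congr (_^-1 ^+ 2); lra.
lra.
Qed.

(** In the application, r n is the autocorrelation <C^n u, u>. *)
Section Toeplitz.
Variables (r : nat -> R) (J : nat).
Hypothesis r_supp : forall n, (J <= n)%N -> r n = 0.
Hypothesis r_le0 : forall n, `|r n| <= r 0%N.

Let eta (d : nat) : R := r d / d%:R.
Let psum (n : nat) : R := \sum_(d < n) eta d.

Let psum_stable n : (J <= n)%N -> psum n = psum J.
Proof.
move=> Jn; rewrite /psum -!(big_mkord xpredT eta) (@big_cat_nat _ _ _ J) //=.
rewrite [X in _ + X]big_nat_cond [X in _ + X]big1 ?addr0 // => i /andP[/andP[Ji _] _].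
by rewrite /eta r_supp // mul0r.
Qed.

Let eta_le d : `|eta d| <= r 0%N.
Proof.
have r0 : 0 <= r 0%N by apply: le_trans (r_le0 0%N).
rewrite /eta; case: d => [|d]; first by rewrite invr0 mulr0 normr0.
rewrite normrM normfV [ `|d.+1%:R| ]ger0_norm // ler_pdivrMr ?ltr0n //.
apply: le_trans (r_le0 _) _; rewrite ler_peMr // ler1n //.
Qed.

Let psum_err n : (n <= J)%N -> `|psum n - psum J| <= J%:R * r 0%N.
Proof.
move=> nJ; rewrite /psum -!(big_mkord xpredT eta) [X in _ - X](@big_cat_nat _ _ _ n) //=.
rewrite opprD addNKr normrN.
apply: le_trans (ler_norm_sum _ _ _) _.
apply: le_trans (ler_sum _ (fun i _ => eta_le i)) _.
rewrite sumr_const_nat -[leLHS]mulr_natl.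
by apply: ler_wpM2r; rewrite ?ler_nat ?leq_subr //; apply: le_trans (r_le0 0%N).
Qed.

(** The summand is an odd function of i - j, so the terms with j < i and those
    with j > i are opposite partial sums of eta; the term j = i is 0 because the
    inverse of 0 is 0. *)
Let row_sum N i : (i < N)%N ->
  \sum_(j < N) r (absz (i%:Z - j%:Z)) / (i%:R - j%:R) = psum i.+1 - psum (N - i).
Proof.
move=> iN; rewrite -(big_mkord xpredT (fun j => r (absz (i%:Z - j%:Z)) / (i%:R - j%:R))).
rewrite (@big_cat_nat _ _ _ i.+1) //=; congr (_ + _).
  rewrite big_nat_rev /= add0n big_mkord; apply: eq_bigr => j _.
  have ji : (j <= i)%N by rewrite -ltnS.
  rewrite subSS /eta; congr (r _ / _); first by lia.
  by rewrite -natrB ?leq_subr // subKn.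
have Ni : (0 < N - i)%N by rewrite subn_gt0.
rewrite /psum -(big_mkord xpredT eta) -{1}[i.+1]add0n big_addn.
rewrite subnS -[in RHS](prednK Ni) big_nat_recl //= /eta invr0 mulr0 add0r -sumrN.
apply: eq_big_nat => j /andP[_ jN].
have -> : absz (i%:Z - (j + i.+1)%N%:Z) = j.+1 by lia.
rewrite -mulrN -invrN; congr (_ / _).
by rewrite -addSnnS natrD opprD addrC addrNK.
Qed.

(** Uniform boundedness of the truncated Hilbert transform S.  With r as above
    the double sum is |Su|^2; its diagonal contributes r 0 times the sum of the
    squares of the kernel, at most 10 (r 0).  By [hker_mul] and antisymmetry the
    rest is - 2 times the sum over i of the kernel at i times a row sum; as the
    kernel is odd and has sum 0, the row sum may be replaced by twice
    psum i.+1 - psum J, which vanishes unless i < J.  For those i the kernel is at most 1/(M - J)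
    in absolute value, whence the size required of M. *)
Lemma toeplitz_hker_le (M : nat) : (J + 4 * J * J < M)%N ->
  \sum_(i < M.*2) \sum_(j < M.*2) hker M i * hker M j * r (absz (i%:Z - j%:Z))
    <= 11 * r 0%N.
Proof.
move=> JM; have r0 : 0 <= r 0%N by apply: le_trans (r_le0 0%N).
pose s (i j : nat) : R := r (absz (i%:Z - j%:Z)) / (i%:R - j%:R).
have sC i j : s j i = - s i j.
  by rewrite /s -[j%:R - i%:R]opprB invrN mulrN; congr (- (r _ / _)); lia.
have E0 : \sum_(i < M.*2) \sum_(j < M.*2) hker M i * hker M j * r (absz (i%:Z - j%:Z))
   = \sum_(i < M.*2) hker M i ^+ 2 * r 0%N
     + \sum_(i < M.*2) \sum_(j < M.*2) (hker M j - hker M i) * s i j.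
  rewrite -big_split /=; apply: eq_bigr => i _.
  rewrite (bigD1 i) //= [in RHS](bigD1 i) //= [X in X * s _ _]subrr mul0r add0r.
  congr (_ + _); first by rewrite subrr -expr2.
  apply: eq_bigr => j ji; rewrite hker_mul; last by rewrite eq_sym.
  by rewrite mulrAC -mulrA.
have E1 : \sum_(i < M.*2) \sum_(j < M.*2) (hker M j - hker M i) * s i j
   = - 2 * \sum_(i < M.*2) hker M i * \sum_(j < M.*2) s i j.
  under eq_bigr do (under eq_bigr do rewrite mulrBl; rewrite sumrB).
  rewrite sumrB exchange_big /=.
  under eq_bigr do under eq_bigr do rewrite sC mulrN.
  under eq_bigr do rewrite sumrN -mulr_sumr.
  rewrite sumrN; under [X in _ - X]eq_bigr do rewrite -mulr_sumr.
  lra.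
have E2 : \sum_(i < M.*2) hker M i * \sum_(j < M.*2) s i j
   = 2 * \sum_(i < M.*2) hker M i * psum i.+1.
  have -> : \sum_(i < M.*2) hker M i * \sum_(j < M.*2) s i j
     = \sum_(i < M.*2) hker M i * psum i.+1 - \sum_(i < M.*2) hker M i * psum (M.*2 - i).
    by rewrite -sumrB; apply: eq_bigr => i _; rewrite row_sum // mulrBr.
  have -> : \sum_(i < M.*2) hker M i * psum (M.*2 - i) = - \sum_(i < M.*2) hker M i * psum i.+1.
    rewrite (reindex_inj rev_ord_inj) /= -sumrN; apply: eq_bigr => i _.
    by rewrite hker_rev // mulNr subKn.
  lra.
have E3 : \sum_(i < M.*2) hker M i * psum i.+1
    = \sum_(i < M.*2) hker M i * (psum i.+1 - psum J).
  under [RHS]eq_bigr do rewrite mulrBr.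
  by rewrite sumrB -mulr_suml sum_hker mul0r subr0.
have E4 : `|\sum_(i < M.*2) hker M i * (psum i.+1 - psum J)| <= 4^-1 * r 0%N.
  rewrite -(big_mkord xpredT (fun i => hker M i * (psum i.+1 - psum J))).
  rewrite (@big_cat_nat _ _ _ J) //=; last by lia.
  rewrite [X in _ + X]big_nat_cond [X in _ + X]big1 ?addr0; last first.
    by move=> i /andP[/andP[Ji _] _]; rewrite psum_stable ?subrr ?mulr0 // ltnW.
  apply: le_trans (ler_norm_sum _ _ _) _.
  have tt i : (0 <= i < J)%N -> `|hker M i * (psum i.+1 - psum J)|
       <= (M%:R - J%:R)^-1 * (J%:R * r 0%N).
    move=> /andP[_ iJ]; rewrite normrM; apply: ler_pM => //; last exact: psum_err.
    have MJ : (J%:R + 1 <= M%:R :> R) by rewrite natr1 ler_nat; lia.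
    have iJ' : (i%:R + 1 <= J%:R :> R) by rewrite natr1 ler_nat; lia.
    have MJ0 : 0 < M%:R - J%:R :> R by lra.
    rewrite /hker normfV lef_pV2 ?posrE ?normr_gt0 ?hker_den_neq0 //.
    by rewrite ler0_norm; lra.
  rewrite big_nat_cond; apply: le_trans (ler_sum _ _) _.
    by move=> i /andP[/tt h _]; exact: h.
  rewrite -big_nat_cond sumr_const_nat subn0 -[leLHS]mulr_natl.
  have MJ : (J%:R + 4 * J%:R * J%:R + 1 <= M%:R :> R).
    by move: JM; rewrite -(ler_nat R) -natr1 natrD !natrM.
  have J0 : 0 <= J%:R :> R by [].
  have MJ0 : 0 < M%:R - J%:R :> R by nra.
  rewrite mulrCA ler_pdivrMl //.
  nra.
have := sum_hker_sqr M.
rewrite E0 E1 E2 E3 -mulr_suml.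
move: E4; rewrite ler_norml => /andP[]; set X := \sum_(_ < _) _; set Y := \sum_(_ < _) _.
move=> *; nra.
Qed.

End Toeplitz.
End HilbertKernel.

(** * An uncertainty principle for commuting up to a central isometry *)

Section AbstractInequality.
Variables (R : realFieldType) (E : lmodType R) (ip : E -> E -> R).
Hypothesis ipD : forall u v w, ip (u + v) w = ip u w + ip v w.
Hypothesis ipZ : forall (a : R) u w, ip (a *: u) w = a * ip u w.
Hypothesis ipC : forall u v, ip u v = ip v u.
Hypothesis ip_ge0 : forall u, 0 <= ip u u.

Let ip0 w : ip 0 w = 0.
Proof. by rewrite -(scale0r 0) ipZ mul0r. Qed.

Let ipN u w : ip (- u) w = - ip u w.
Proof. by rewrite -scaleN1r ipZ mulN1r. Qed.

Let ipB u v w : ip (u - v) w = ip u w - ip v w.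
Proof. by rewrite ipD ipN. Qed.

Let ipDr u v w : ip w (u + v) = ip w u + ip w v.
Proof. by rewrite ipC ipD !(ipC w). Qed.

Let ipBr u v w : ip w (u - v) = ip w u - ip w v.
Proof. by rewrite ipC ipB !(ipC w). Qed.

Let ip_suml (I : finType) (F : I -> E) w :
  ip (\sum_i F i) w = \sum_i ip (F i) w.
Proof. by apply: (big_morph (ip^~ w)). Qed.

Let ip_sumr (I : finType) (F : I -> E) w :
  ip w (\sum_i F i) = \sum_i ip w (F i).
Proof. by rewrite ipC ip_suml; apply: eq_bigr => i _; rewrite ipC. Qed.

Let ip_le_half u v : ip u v <= 2^-1 * (ip u u + ip v v).
Proof.
have := ip_ge0 (u - v); rewrite ipB !ipBr (ipC v u).
by move=> h; rewrite ler_pdivlMl //; lra.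
Qed.

Let ip_ge_half u v : - (2^-1 * (ip u u + ip v v)) <= ip u v.
Proof.
by have := ip_le_half (- u) v; rewrite !ipN (ipC u (- u)) ipN; lra.
Qed.

Let ip_sum_le u v : ip (u + v) (u + v) <= 2 * (ip u u + ip v v).
Proof.
have := ip_ge0 (u - v); rewrite ipB !ipBr ipD !ipDr (ipC v u); lra.
Qed.

Let ip_sub_le u v : ip (u - v) (u - v) <= 2 * (ip u u + ip v v).
Proof.
have := ip_ge0 (u + v); rewrite ipB !ipBr ipD !ipDr (ipC v u); lra.
Qed.

Section CentralShift.
Variable C : E -> E.
Hypothesis C_iso : forall u v, ip (C u) (C v) = ip u v.
(* For translation by an element of infinite order, supports eventually become
   disjoint. *)
Hypothesis C_mix : forall u v, exists J, forall j, (J <= j)%N -> ip (iter j C u) v = 0.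

Let Cn_iso n u v : ip (iter n C u) (iter n C v) = ip u v.
Proof. by elim: n => //= n IH; rewrite C_iso. Qed.

Let ip_iter u i j :
  ip (iter i C u) (iter j C u) = ip (iter (absz (i%:Z - j%:Z)) C u) u.
Proof.
have [ij|ji] := leqP i j.
  have -> : absz (i%:Z - j%:Z) = (j - i)%N by lia.
  by rewrite -{1}(subnKC ij) iterD Cn_iso ipC.
have -> : absz (i%:Z - j%:Z) = (i - j)%N by lia.
by rewrite -{1}(subnKC (ltnW ji)) iterD Cn_iso.
Qed.

(** The form <Su, v> for the truncated Hilbert transform S; shifting v by C^M
    takes the place of negative powers of C. *)
Definition hilbert_form (M : nat) (u v : E) : R :=
  \sum_(i < M.*2) hker R M i * ip (iter i C u) (iter M C v).

Lemma hilbert_form_le (u : E) : exists M0, forall M, (M0 <= M)%N -> forall v,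
  hilbert_form M u v <= 2^-1 * (11 * ip u u + ip v v).
Proof.
have [J HJ] := C_mix u u.
exists (J + 4 * J * J).+1 => M MJ v.
pose Su := \sum_(i < M.*2) hker R M i *: iter i C u.
have SuSu : ip Su Su <= 11 * ip u u.
  have bnd n : `|ip (iter n C u) u| <= ip u u.
    rewrite ler_norml.
    have := ip_le_half (iter n C u) u; have := ip_ge_half (iter n C u) u.
    by rewrite Cn_iso => h1 h2; apply/andP; split; lra.
  have := toeplitz_hker_le (r := fun n => ip (iter n C u) u) HJ bnd MJ.
  apply: le_trans.
  rewrite /Su ip_suml le_eqVlt; apply/orP; left; apply/eqP.
  apply: eq_bigr => i _; rewrite ip_sumr; apply: eq_bigr => j _.
  by rewrite ipZ ipC ipZ ipC ip_iter mulrA.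
have -> : hilbert_form M u v = ip Su (iter M C v).
  by rewrite /hilbert_form ip_suml; apply: eq_bigr => i _; rewrite ipZ.
have := ip_le_half Su (iter M C v); rewrite Cn_iso; lra.
Qed.

Definition cweight (j : nat) : R := (j%:R ^+ 2 - 4^-1)^-1.

Let natr_ge1 j : (0 < j)%N -> 1 <= j%:R :> R.
Proof. by rewrite ler1n. Qed.

Let cweight_den_gt0 j : (0 < j)%N -> 0 < j%:R ^+ 2 - 4^-1 :> R.
Proof. by move=> /natr_ge1; nra. Qed.

Let cweight_telescope j : (0 < j)%N ->
  cweight j = (j%:R - 2^-1)^-1 - (j%:R + 2^-1)^-1.
Proof.
move=> /natr_ge1; rewrite /cweight; move: (j%:R) => x x1.
have -> : x ^+ 2 - 4^-1 = (x - 2^-1) * (x + 2^-1) by field.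
have -> : x + 2^-1 = (x - 2^-1) + 1 by field.
have : 0 < x - 2^-1 by lra.
move: (x - 2^-1) => p p0; have p1 : 0 < p + 1 by lra.
by field; rewrite !gt_eqF.
Qed.

Let sum_cweight_le (M : nat) : \sum_(1 <= j < M) cweight j <= 2.
Proof.
case: M => [|M]; first by rewrite big_geq.
have -> : \sum_(1 <= j < M.+1) cweight j = 2 - (M%:R + 2^-1)^-1.
  elim: M => [|M IH]; first by rewrite big_geq // add0r invrK subrr.
  rewrite big_nat_recr //= IH cweight_telescope //.
  have -> : M.+1%:R - 2^-1 = M%:R + 2^-1 :> R by rewrite -[M.+1%:R]natr1; lra.
  by rewrite addrA subrK.
by rewrite gerBl invr_ge0 addr_ge0 ?invr_ge0.
Qed.

Let hker_step M i j : (0 < i)%N ->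
   (i%:R - M%:R) ^+ 2 = j%:R ^+ 2 :> R ->
  hker R M i - hker R M i.-1 = - cweight j.
Proof.
case: i => //= i _; rewrite /cweight => <-.
move: (hker_den_neq0 R M i) (hker_den_neq0 R M i.+1); rewrite /hker.
have -> : i%:R - M%:R + 2^-1 = (i.+1%:R - M%:R) - 2^-1 :> R.
  by rewrite -[i.+1%:R]natr1; field.
move: (i.+1%:R - M%:R) => x hm hp.
have -> : x ^+ 2 - 4^-1 = (x - 2^-1) * (x + 2^-1) by field.
have ex : x - 2^-1 = (x + 2^-1) - 1 by field.
rewrite {}ex in hm *; move: (x + 2^-1) hp hm => p p0 p1.
by field; rewrite p0 p1.
Qed.

(** The form <Wu, v> for W = sum_k w_k (2 - C^k - C^-k): the constant 4 is twice
    the sum of all w_k. *)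
Definition center_form (M : nat) (u v : E) : R :=
  4 * ip u v
  - \sum_(1 <= j < M) cweight j * (ip (iter j C u) v + ip u (iter j C v)).

Hypothesis C_additive : forall u v, C (u - v) = C u - C v.

Let CnB n u v : iter n C (u - v) = iter n C u - iter n C v.
Proof. by elim: n => //= n ->; rewrite C_additive. Qed.

(** The factorization W = S (1 - C): by summation by parts the coefficient of
    C^j in S (1 - C) is 1/(j + 1/2) - 1/(j - 1/2) = - w_j, and w_0 = - 4.  The two
    boundary terms vanish as soon as M exceeds the supports. *)
Lemma hilbert_form_subC (M : nat) (u v : E) : (0 < M)%N ->
  ip (iter M C u) v = 0 -> ip u (iter M C v) = 0 ->
  hilbert_form M (u - C u) v = center_form M u v.
Proof.
move=> M0 uv0 uv0'.
pose r i := ip (iter i C u) (iter M C v).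
have r2M : r M.*2 = 0 by rewrite /r -addnn iterD Cn_iso.
have -> : hilbert_form M (u - C u) v
    = \sum_(1 <= i < M.*2) (hker R M i - hker R M i.-1) * r i.
  have -> : hilbert_form M (u - C u) v
    = \sum_(0 <= i < M.*2) hker R M i * r i - \sum_(0 <= i < M.*2) hker R M i * r i.+1.
    rewrite !big_mkord -sumrB; apply: eq_bigr => i _.
    by rewrite CnB ipB mulrBr -iterSr.
  have M2 : M.*2 = M.*2.-1.+1 by rewrite prednK // double_gt0.
  rewrite {1}M2 big_nat_recl // [r 0%N]uv0' mulr0 add0r.
  rewrite [in X in _ - X]M2 big_nat_recr //= -M2 r2M mulr0 addr0.
  rewrite [in RHS]M2 big_add1 -sumrB; apply: eq_bigr => i _.
  by rewrite /= mulrBl.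
rewrite (@big_cat_nat _ _ _ M) //=; last by rewrite -addnn leq_addr.
rewrite [X in _ + X]big_ltn; last by rewrite -addnn -addn1 leq_add2l.
have -> : (hker R M M - hker R M M.-1) * r M = 4 * ip u v.
  rewrite /r Cn_iso (@hker_step _ _ 0%N) // ?subrr ?expr0n //.
  by rewrite /cweight expr0n sub0r invrN invrK opprK.
have -> : \sum_(M.+1 <= i < M.*2) (hker R M i - hker R M i.-1) * r i
    = - \sum_(1 <= j < M) cweight j * ip (iter j C u) v.
  rewrite -addn1 addnC big_addn -addnn addnK -sumrN; apply: eq_big_nat => j /andP[j0 jM].
  rewrite (@hker_step _ _ j) ?natrD ?addrK ?addn_gt0 ?j0 //.
  by rewrite mulNr /r addnC iterD Cn_iso.
have -> : \sum_(1 <= i < M) (hker R M i - hker R M i.-1) * r i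
    = - \sum_(1 <= j < M) cweight j * ip u (iter j C v).
  rewrite big_nat_rev -sumrN; apply: eq_big_nat => j /andP[j0 jM].
  rewrite add1n subSS (@hker_step _ _ j) ?subn_gt0 //.
    rewrite mulNr /r -{2}(subnK (ltnW jM)) iterD Cn_iso //.
  by rewrite natrB ?(ltnW jM) // addrAC subrr sub0r sqrrN.
rewrite /center_form; under [in RHS]eq_bigr do rewrite mulrDr.
rewrite big_split /=; lra.
Qed.

Let center_form_expand M x g :
  center_form M (x - g) (x - g)
  = center_form M x x - 2 * center_form M x g + center_form M g g.
Proof.
have -> : center_form M x x - 2 * center_form M x g + center_form M g g =
   4 * (ip x x - 2 * ip x g + ip g g) - \sum_(1 <= j < M)
     (cweight j * (ip (iter j C x) x + ip x (iter j C x))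
      - 2 * (cweight j * (ip (iter j C x) g + ip x (iter j C g)))
      + cweight j * (ip (iter j C g) g + ip g (iter j C g))).
  by rewrite big_split /= sumrB -mulr_sumr /center_form; lra.
rewrite /center_form; congr (_ - _).
  by rewrite ipB !ipBr (ipC g x); lra.
apply: eq_bigr => j _; rewrite CnB !ipB !ipBr.
rewrite (ipC x (iter j C x)) (ipC g (iter j C g)) (ipC g (iter j C x)) (ipC x (iter j C g)); lra.
Qed.

(** The partial sums of w_k are at most 2, so replacing them by 2 in front of the
    diagonal term only increases the form. *)
Lemma sum_le_center_form M g :
  \sum_(1 <= k < M) ip (iter k C g - g) (iter k C g - g) / k%:R ^+ 2
    <= center_form M g g.
Proof.
apply: (@le_trans _ _ (\sum_(1 <= k < M)
    cweight k * ip (iter k C g - g) (iter k C g - g))).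
  rewrite big_nat_cond [leRHS]big_nat_cond; apply: ler_sum => k /andP[/andP[k0 _] _].
  rewrite mulrC ler_wpM2r ?ip_ge0 // lef_pV2 ?posrE ?cweight_den_gt0 ?exprn_gt0 ?ltr0n //.
  by rewrite gerBl invr_ge0.
have -> : \sum_(1 <= k < M) cweight k * ip (iter k C g - g) (iter k C g - g)
  = 2 * ip g g * (\sum_(1 <= k < M) cweight k)
    - \sum_(1 <= k < M) cweight k * (ip (iter k C g) g + ip g (iter k C g)).
  rewrite mulr_sumr -sumrB; apply: eq_bigr => k _.
  by rewrite ipB !ipBr Cn_iso (ipC g (iter k C g)); lra.
rewrite /center_form lerB // -mulrA [ip g g * _]mulrC mulrA ler_wpM2r ?ip_ge0 //.
by have := sum_cweight_le M; lra.
Qed.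

Variables (A B : E -> E).
Hypothesis A_iso : forall u v, ip (A u) (A v) = ip u v.
Hypothesis B_iso : forall u v, ip (B u) (B v) = ip u v.
Hypothesis A_additive : forall u v, A (u - v) = A u - A v.
Hypothesis B_additive : forall u v, B (u - v) = B u - B v.
Hypothesis CA : forall u, C (A u) = A (C u).
Hypothesis CB : forall u, C (B u) = B (C u).
Hypothesis AB : forall u, A (B u) = C (B (A u)).

Let hilbert_formBl M u u' v :
  hilbert_form M (u - u') v = hilbert_form M u v - hilbert_form M u' v.
Proof.
by rewrite /hilbert_form -sumrB; apply: eq_bigr => i _; rewrite CnB ipB mulrBr.
Qed.

Let hilbert_formBr M u v v' :
  hilbert_form M u (v - v') = hilbert_form M u v - hilbert_form M u v'.
Proof.
by rewrite /hilbert_form -sumrB; apply: eq_bigr => i _; rewrite CnB ipBr mulrBr.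
Qed.

Let CnN n u : iter n C (- u) = - iter n C u.
Proof.
have Cn0 : iter n C 0 = 0 by rewrite -(subrr 0) CnB !subrr.
by rewrite -sub0r CnB Cn0 sub0r.
Qed.

Let hilbert_formNl M u v : hilbert_form M (- u) v = - hilbert_form M u v.
Proof.
by rewrite /hilbert_form -sumrN; apply: eq_bigr => i _; rewrite CnN ipN mulrN.
Qed.

Let hilbert_formNr M u v : hilbert_form M u (- v) = - hilbert_form M u v.
Proof.
rewrite /hilbert_form -sumrN; apply: eq_bigr => i _.
by rewrite CnN ipC ipN mulrN ipC.
Qed.

Let hilbert_form_iso T M u v : (forall u v, ip (T u) (T v) = ip u v) ->
  (forall u, C (T u) = T (C u)) -> hilbert_form M (T u) (T v) = hilbert_form M u v.
Proof.
move=> Ti CT; have CnT n w : iter n C (T w) = T (iter n C w).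
  by elim: n => //= n ->.
by apply: eq_bigr => i _; rewrite !CnT Ti.
Qed.

Let center_form_iso T M u v : (forall u v, ip (T u) (T v) = ip u v) ->
  (forall u, C (T u) = T (C u)) -> center_form M (T u) (T v) = center_form M u v.
Proof.
move=> Ti CT; have CnT n w : iter n C (T w) = T (iter n C w).
  by elim: n => //= n ->.
by rewrite /center_form Ti; congr (_ - _); apply: eq_bigr => i _; rewrite !CnT !Ti.
Qed.

(** Quantitative noncommutativity: x = BAg satisfies Q(g) = W(x, g) + Q(x - g)/2
    by invariance of Q, and x - Cx = BAg - ABg is a difference of two iterated
    differences of g, so both terms are bounded by [hilbert_form_le]. *)
Lemma commutator_energy_le g K :
  \sum_(1 <= k < K) ip (iter k C g - g) (iter k C g - g) / k%:R ^+ 2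
    <= 29 * (ip (A g - g) (A g - g) + ip (B g - g) (B g - g)).
Proof.
set w1 := A g - g; set w2 := B g - g.
pose x := B (A g); pose h := x - g.
have hE : h = B w1 + w2.
  by rewrite /h /x /w1 /w2 B_additive addrA subrK.
have [M1 H1] := hilbert_form_le (- B w1).
have [M2 H2] := hilbert_form_le (A w2).
have [M3 H3] := hilbert_form_le (h - C h).
have [J1 HJ1] := C_mix x g.
have [J2 HJ2] := C_mix g x.
have [J3 HJ3] := C_mix h h.
pose M := (M1 + M2 + M3 + J1 + J2 + J3 + K).+1.
have {}H1 := H1 M ltac:(rewrite /M; lia) w2.
have {}H2 := H2 M ltac:(rewrite /M; lia) w1.
have {}H3 := H3 M ltac:(rewrite /M; lia) h.
have {}HJ1 := HJ1 M ltac:(rewrite /M; lia).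
have {}HJ2 := HJ2 M ltac:(rewrite /M; lia).
have {}HJ3 := HJ3 M ltac:(rewrite /M; lia).
have KM : (K <= M)%N by rewrite /M; lia.
have Mgt0 : (0 < M)%N by [].
move: M KM Mgt0 H1 H2 H3 HJ1 HJ2 HJ3 => M KM Mgt0 H1 H2 H3 HJ1 HJ2 HJ3.
have E1 : center_form M x g = hilbert_form M (- B w1) w2 + hilbert_form M (A w2) w1.
  rewrite -hilbert_form_subC //; last by rewrite ipC.
  have -> : x - C x = (B w1 - w1) - (A w2 - w2).
    rewrite /x -AB /w1 /w2 A_additive B_additive.
    rewrite -[B (A g) - _ - _]addrA -opprD -[A (B g) - _ - _]addrA -opprD addrCA.
    by rewrite [- (A (B g) - _)]opprB [RHS]addrA subrK.
  (* Summation by parts: the difference moves from the first to the second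
     argument. *)
  have e1 : hilbert_form M (B w1 - w1) g = hilbert_form M (- B w1) w2.
    rewrite hilbert_formBl -(hilbert_form_iso M w1 g B_iso CB) -hilbert_formBr.
    by rewrite -(opprB (B g)) -/w2 hilbert_formNr hilbert_formNl.
  have e2 : hilbert_form M (A w2 - w2) g = - hilbert_form M (A w2) w1.
    rewrite hilbert_formBl -(hilbert_form_iso M w2 g A_iso CA) -hilbert_formBr.
    by rewrite -(opprB (A g)) hilbert_formNr.
  by rewrite hilbert_formBl e1 e2 opprK.
have E2 : center_form M h h = hilbert_form M (h - C h) h by rewrite hilbert_form_subC // ipC.
have E3 : center_form M x x = center_form M g g by rewrite /x !center_form_iso.
have E4 := center_form_expand M x g.
have N3 := ip_sub_le h (C h).
have N4 := ip_sum_le (B w1) w2.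
rewrite -hE B_iso in N4. rewrite C_iso in N3.
rewrite !ipN (ipC _ (- _)) ipN opprK B_iso in H1; rewrite A_iso in H2.
rewrite -/h E2 E3 in E4.
have mono : \sum_(1 <= k < K) ip (iter k C g - g) (iter k C g - g) / k%:R ^+ 2
  <= \sum_(1 <= k < M) ip (iter k C g - g) (iter k C g - g) / k%:R ^+ 2.
  have [K0|K0] := posnP K.
    rewrite K0 big_geq //; apply: sumr_ge0 => k _.
    by rewrite divr_ge0 // exprn_ge0.
  rewrite [leRHS](big_cat_nat _ KM) //= lerDl sumr_ge0 // => k _.
  by rewrite divr_ge0 // exprn_ge0.
have := le_trans mono (sum_le_center_form M g).
have := ip_ge0 w1; have := ip_ge0 w2; rewrite -/w1 -/w2; lra.
Qed.

End CentralShift.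
End AbstractInequality.

(** * Words, balls and the center of the Heisenberg group *)

Section HeisGroup.
Local Open Scope quotient_scope.
Local Open Scope group_scope.

Lemma heis_piM (u v : word) : \pi_heis u * \pi_heis v = \pi_heis (u ++ v).
Proof. exact: heis_mulE. Qed.

Lemma heis_letterV (l : letter) : \pi_heis [:: linv l] = (\pi_heis [:: l])^-1.
Proof.
apply: (mulgI (\pi_heis [:: l])); rewrite mulgV heis_piM.
by apply/heis_piP; exact: heis_cancel.
Qed.

Lemma hcE : hc = \pi_heis wcomm.
Proof.
by rewrite /hc /ha /hb -!heis_letterV !heis_piM.
Qed.

Lemma hc_central (x : heis) : commute hc x.
Proof.
elim/heisW: x => w; rewrite /commute hcE !heis_piM.
by apply/heis_piP; exact: heis_central.
Qed.

Lemma ha_hb : ha * hb = hb * ha * hc.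
Proof. by rewrite -(hc_central (hb * ha)) /hc !mulgA !mulgVK. Qed.

Lemma heis_gensV (s : heis) : s \in heis_gens -> s^-1 \in heis_gens.
Proof.
by rewrite !inE => /or4P[] /eqP ->; rewrite ?invgK eqxx ?orbT.
Qed.

Lemma heis_prod_cat (w1 w2 : seq heis) :
  heis_prod (w1 ++ w2) = heis_prod w1 * heis_prod w2.
Proof. by rewrite /heis_prod big_cat. Qed.

Lemma heis_prod_cons (s : heis) (w : seq heis) :
  heis_prod (s :: w) = s * heis_prod w.
Proof. by rewrite /heis_prod big_cons. Qed.

Lemma heis_ballP (n : nat) (x : heis) :
  heis_ball n x <-> exists w : seq heis,
    [/\ {subset w <= heis_gens}, (size w <= n)%N & heis_prod w = x].
Proof.
rewrite /heis_ball /dW /=; split.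
  case: ex_minnP => m + _ mn; rewrite invg1 mul1g => /asboolP[w [wS <-]].
  by exists w; rewrite size_tuple.
move=> [w [wS wn wx]]; case: ex_minnP => m _ mmin.
apply: leq_trans wn; apply: mmin; rewrite invg1 mul1g.
by apply/asboolP; exists (in_tuple w).
Qed.

Lemma heis_ball_le (m n : nat) : (m <= n)%N -> heis_ball m `<=` heis_ball n.
Proof. by move=> mn x; rewrite /heis_ball /= => /leq_trans; apply. Qed.

Lemma heis_ball1 (n : nat) : heis_ball n 1.
Proof. by apply/heis_ballP; exists [::]; rewrite /heis_prod big_nil. Qed.

Lemma heis_ball_gen (s : heis) : s \in heis_gens -> heis_ball 1 s.
Proof.
move=> sS; apply/heis_ballP; exists [:: s]; split=> //.
  by move=> t; rewrite inE => /eqP ->.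
by rewrite heis_prod_cons /heis_prod big_nil mulg1.
Qed.

Lemma heis_ballM (m n : nat) (x y : heis) :
  heis_ball m x -> heis_ball n y -> heis_ball (m + n) (x * y).
Proof.
move=> /heis_ballP[v [vS vm <-]] /heis_ballP[w [wS wn <-]].
apply/heis_ballP; exists (v ++ w); rewrite heis_prod_cat size_cat leq_add //.
by split=> // s; rewrite mem_cat => /orP[/vS|/wS].
Qed.

Lemma heis_ballV (n : nat) (x : heis) : heis_ball n x -> heis_ball n x^-1.
Proof.
move=> /heis_ballP[w [+ + <-]]; elim: w n => [|s w IH] n wS.
  by move=> _; rewrite /heis_prod big_nil invg1; exact: heis_ball1.
case: n => // n /= wn; rewrite heis_prod_cons invgM -addn1.
apply: heis_ballM; first by apply: IH => // t tw; apply: wS; rewrite inE tw orbT.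
by apply: heis_ball_gen; apply: heis_gensV; apply: wS; rewrite inE eqxx.
Qed.

Lemma heis_ballX (n : nat) (s : heis) : s \in heis_gens -> heis_ball n (s ^+ n).
Proof.
move=> sS; elim: n => [|n IH]; first by rewrite expg0; exact: heis_ball1.
by rewrite expgSr -addn1; apply: heis_ballM => //; exact: heis_ball_gen.
Qed.

Definition hlen (x : heis) : nat := dW 1 x.

Lemma hlenM (x y : heis) : (hlen (x * y)%g <= hlen x + hlen y)%N.
Proof. by apply: heis_ballM; exact: leqnn. Qed.

Lemma hlenV (x : heis) : (hlen x^-1%g <= hlen x)%N.
Proof. by apply: heis_ballV; exact: leqnn. Qed.

Lemma hlen_prod (w : seq heis) : {subset w <= heis_gens} ->
  (hlen (heis_prod w) <= size w)%N.
Proof. by move=> wS; apply/heis_ballP; exists w. Qed.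

Definition hball (n : nat) : seq heis := fset_set (heis_ball n).

Lemma mem_hball (n : nat) (x : heis) : (x \in hball n) = (hlen x <= n)%N.
Proof.
rewrite in_fset_set; last exact: finite_heis_ball.
by apply/idP/idP; rewrite inE.
Qed.

Lemma hball_uniq (n : nat) : uniq (hball n). Proof. exact: fset_uniq. Qed.

Lemma ha_gen : ha \in heis_gens. Proof. by rewrite inE eqxx. Qed.
Lemma hb_gen : hb \in heis_gens. Proof. by rewrite !inE eqxx orbT. Qed.

Lemma expa_hb (m : nat) : ha ^+ m * hb = hb * ha ^+ m * hc ^+ m.
Proof.
elim: m => [|m IH]; first by rewrite !expg0 mul1g !mulg1.
rewrite expgSr -mulgA ha_hb !mulgA IH -[LHS]mulgA -[_ * hc ^+ m * _]mulgA.
rewrite (commute_sym (commuteX m (commute_sym (hc_central _)))).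
by rewrite expgSr !mulgA.
Qed.

Lemma expa_expb (m n : nat) : ha ^+ m * hb ^+ n = hb ^+ n * ha ^+ m * hc ^+ (m * n).
Proof.
elim: n => [|n IH]; first by rewrite muln0 !expg0 mul1g !mulg1.
rewrite expgSr mulgA IH -mulgA.
rewrite (commute_sym (commuteX (m * n) (commute_sym (hc_central _)))).
rewrite mulgA -[_ * ha ^+ m * hb]mulgA expa_hb mulnS expgnDr !mulgA.
by [].
Qed.

Lemma hcXM (m n : nat) :
  hc ^+ (m * n) = ha ^+ m * hb ^+ n * (ha ^+ m)^-1 * (hb ^+ n)^-1.
Proof.
rewrite expa_expb.
have cc y : commute (hc ^+ (m * n)) y by apply/commute_sym/commuteX/commute_sym/hc_central.
by rewrite -(cc (hb ^+ n * ha ^+ m)) -!mulgA mulVKg mulgV mulg1.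
Qed.

(** The commutator of ha^m and hb^n reaches hc^(mn) in 2(m + n) letters: this is
    the quadratic distortion of the center. *)
Lemma heis_ball_hcXM (m n : nat) : heis_ball (2 * (m + n)) (hc ^+ (m * n)).
Proof.
rewrite hcXM (_ : (2 * (m + n) = m + n + m + n)%N); last by lia.
by do 3? apply: heis_ballM; try apply: heis_ballV; apply: heis_ballX;
  rewrite ?ha_gen ?hb_gen.
Qed.

(** Write k = q r + s with q <= r and s < r, and use [heis_ball_hcXM] for both
    hc^(q r) and hc^(s 1). *)
Lemma heis_ball_hcX (r k : nat) : (0 < r)%N -> (k <= r ^ 2)%N ->
  heis_ball (6 * r) (hc ^+ k).
Proof.
move=> r0 kr; rewrite (divn_eq k r) expgnDr.
have q : (k %/ r <= r)%N by rewrite -[leqRHS](mulnK r r0) leq_div2r // mulnn.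
have s : (k %% r < r)%N by rewrite ltn_mod.
apply: (@heis_ball_le (2 * (k %/ r + r) + 2 * (k %% r + 1))); first by lia.
apply: heis_ballM; first exact: heis_ball_hcXM.
by have := heis_ball_hcXM (k %% r) 1; rewrite muln1.
Qed.

End HeisGroup.

(** * Coordinates and normal forms *)

Section HeisCoordinates.
Local Open Scope quotient_scope.

Definition zheis : Type := (int * int * int)%type.
(** The product of the unipotent upper triangular 3x3 integer matrices with
    entries x, y above the diagonal and z in the corner. *)
Definition zmul (p q : zheis) : zheis :=
  (p.1.1 + q.1.1, p.1.2 + q.1.2, p.2 + q.2 + p.1.1 * q.1.2).

Lemma zmulA : associative zmul.
Proof.
move=> [[x y] z] [[x' y'] z'] [[x'' y''] z''].
by rewrite /zmul /=; congr (_, _, _); ring.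
Qed.

Lemma zmul0 : left_id (0, 0, 0) zmul.
Proof. by move=> [[x y] z]; rewrite /zmul /= mul0r !add0r addr0. Qed.

Definition zletter (l : letter) : zheis :=
  let e : int := (-1) ^+ l.2 in if l.1 then (0, e, 0) else (e, 0, 0).

Definition zword (w : word) : zheis := foldr (zmul \o zletter) (0, 0, 0) w.

Lemma zword_cat (u v : word) : zword (u ++ v) = zmul (zword u) (zword v).
Proof. by elim: u => [|l u IH]; rewrite ?zmul0 //= IH zmulA. Qed.

Lemma zword_eq (u v : word) : heis_eq u v -> zword u = zword v.
Proof.
elim=> //.
- by move=> u1 v1 w1 _ -> _ ->.
- by move=> u1 u2 v1 v2 _ e1 _ e2; rewrite !zword_cat e1 e2.
- by move=> [[] []].
- move=> w; rewrite !zword_cat; case: (zword w) => [[x y] z].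
  by rewrite /zmul /=; congr (_, _, _); ring.
Qed.

Definition hcoord (x : heis) : zheis := zword (repr x).

Lemma hcoord_pi (w : word) : hcoord (\pi_heis w) = zword w.
Proof. by apply: zword_eq; exact: heis_repr. Qed.

Lemma hcoordM (x y : heis) : hcoord (x * y)%g = zmul (hcoord x) (hcoord y).
Proof.
elim/heisW: x => u; elim/heisW: y => v.
by rewrite heis_piM !hcoord_pi zword_cat.
Qed.

Lemma hcoord_expc (n : nat) : hcoord (hc ^+ n)%g = (0, 0, n%:Z).
Proof.
elim: n => [|n IH]; first by rewrite expg0 -[1%g]/(\pi_heis [::]) hcoord_pi.
rewrite expgS hcoordM IH hcE hcoord_pi /zmul /=; congr (_, _, _).
by rewrite intS; ring.
Qed.

Lemma hcoord_expa (n : nat) : hcoord (ha ^+ n)%g = (n%:Z, 0, 0).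
Proof.
elim: n => [|n IH]; first by rewrite expg0 -[1%g]/(\pi_heis [::]) hcoord_pi.
rewrite expgS hcoordM IH /ha hcoord_pi /zmul /=.
by congr (_, _, _); rewrite ?intS; ring.
Qed.

Lemma hcoord_expb (n : nat) : hcoord (hb ^+ n)%g = (0, n%:Z, 0).
Proof.
elim: n => [|n IH]; first by rewrite expg0 -[1%g]/(\pi_heis [::]) hcoord_pi.
rewrite expgS hcoordM IH /hb hcoord_pi /zmul /=.
by congr (_, _, _); rewrite ?intS; ring.
Qed.

Definition zexpg (x : heis) (m : int) : heis :=
  match m with Posz n => (x ^+ n)%g | Negz n => (x ^- n.+1)%g end.

Lemma zexpgS (x : heis) (m : int) : zexpg x (m + 1) = (zexpg x m * x)%g.
Proof.
case: m => [n|n].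
  have -> : Posz n + 1 = Posz n.+1 by lia.
  by rewrite /= expgSr.
case: n => [|n]; first by rewrite /= expg1 mulVg.
have -> : Negz n.+1 + 1 = Negz n by lia.
by rewrite /= [in RHS]expgS invgM mulgVK.
Qed.

Lemma zexpgP (x : heis) (m : int) : zexpg x (m - 1) = (zexpg x m * x^-1)%g.
Proof. by rewrite -{2}[m](subrK 1) zexpgS mulgK. Qed.

Lemma zexpg_comm (x y : heis) (m : int) : commute x y -> commute (zexpg x m) y.
Proof.
move=> xy; apply: commute_sym; case: m => n /=; last apply: commuteV;
 by apply: commuteX; apply: commute_sym.
Qed.

Lemma zexpgD (x : heis) (m n : int) : zexpg x (m + n) = (zexpg x m * zexpg x n)%g.
Proof.
elim: n => [|n IH|n IH]; first by rewrite addr0 /= expg0 mulg1.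
  by rewrite -addn1 PoszD addrA zexpgS IH -mulgA -zexpgS.
have -> : - n.+1%:Z = - n%:Z - 1 by lia.
by rewrite addrA zexpgP IH -mulgA -zexpgP.
Qed.

Lemma zexpgN (x : heis) (m : int) : zexpg x (- m) = (zexpg x m)^-1%g.
Proof.
apply: (mulgI (zexpg x m)); rewrite mulgV -zexpgD subrr /=; exact: expg0.
Qed.

Lemma zexpa_hb (m : int) : (zexpg ha m * hb = hb * zexpg ha m * zexpg hc m)%g.
Proof.
have cc n y : commute (zexpg hc n) y by apply: zexpg_comm; exact: hc_central.
case: m => n; first exact: expa_hb.
rewrite -[Negz n]/(- (n.+1%:Z)) !zexpgN; set a := zexpg ha _; set c := zexpg hc _.
have e : (a * hb = hb * a * c)%g by exact: expa_hb.
have ca : (c * a^-1 = a^-1 * c)%g by exact: cc.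
apply: (mulgI a); rewrite mulVKg !mulgA e.
by rewrite -[(_ * c * a^-1)%g]mulgA ca mulgA !mulgK.
Qed.

Lemma zexpa_hbV (m : int) :
  (zexpg ha m * hb^-1 = hb^-1 * zexpg ha m * (zexpg hc m)^-1)%g.
Proof.
have cb : commute (zexpg hc m)^-1%g hb.
  by apply/commute_sym/commuteV/commute_sym/zexpg_comm/hc_central.
apply: (mulIg hb); apply: (mulgI hb); rewrite mulgVK -!mulgA cb mulVKg.
by rewrite !mulgA zexpa_hb mulgK.
Qed.

(** The order hb, ha, hc is chosen so that right multiplication by a generator
    changes the exponents by an explicit formula. *)
Definition normal_form (p : zheis) : heis :=
  (zexpg hb p.1.2 * zexpg ha p.1.1 * zexpg hc p.2)%g.

(** Read off the exponents in the matrix coordinates; nonnegative exponents are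
    enough for a lower bound on the size of balls. *)
Lemma normal_form_nat_inj :
  injective (fun t : nat * nat * nat =>
    normal_form (t.1.1%:Z, t.1.2%:Z, t.2%:Z)).
Proof.
move=> [[x y] z] [[x' y'] z'] /(congr1 hcoord).
rewrite /normal_form /= !hcoordM !hcoord_expc !hcoord_expa !hcoord_expb /zmul /=.
by rewrite !(add0r, addr0, mul0r, mulr0) => -[-> -> ->].
Qed.

Definition zbox (n : nat) (p : zheis) : Prop :=
  [/\ `|p.1.1| <= n%:Z, `|p.1.2| <= n%:Z & `|p.2| <= (n * n)%:Z].

(** By induction on words: a letter ha or its inverse changes the exponent of ha
    by 1; a letter hb or its inverse changes the exponent of hb by 1 and that of
    hc by the exponent of ha, which is at most the number of letters read. *)
Lemma heis_ball_normal_form (n : nat) (g : heis) : heis_ball n g ->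
  exists2 p, zbox n p & g = normal_form p.
Proof.
move=> /heis_ballP[w [wS wn <-]].
suff [p bp ->] : exists2 p, zbox (size w) p & heis_prod w = normal_form p.
  exists p => //; case: bp => h1 h2 h3; split; [lia|lia|nia].
have cc m y : commute (zexpg hc m) y by apply: zexpg_comm; exact: hc_central.
elim/last_ind: w wS {wn} => [|w s IH] wS.
  exists (0, 0, 0) => //.
  by rewrite /heis_prod big_nil /normal_form /= !expg0 !mulg1.
have [t tw|[[x y] z] [/= bx by_ bz] ew] := IH.
  by apply: wS; rewrite mem_rcons inE tw orbT.
have : s \in heis_gens by apply: wS; rewrite mem_rcons inE eqxx.
rewrite size_rcons -cats1 heis_prod_cat heis_prod_cons {2}/heis_prod big_nil mulg1 ew.
have shift m : (zexpg hb y * zexpg ha m * zexpg hc z * s)%g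
  = (zexpg hb y * (zexpg ha m * s) * zexpg hc z)%g.
  by rewrite -mulgA cc !mulgA.
rewrite /normal_form /= shift //.
rewrite !inE => /or4P[] /eqP ->.
- exists (x + 1, y, z); last by rewrite zexpgS !mulgA.
  by split=> /=; [lia|lia|nia].
- exists (x, y + 1, z + x); last first.
    by rewrite zexpa_hb /= zexpgS zexpgD [(zexpg hc z * _)%g]cc !mulgA.
  by split=> /=; [lia|lia|nia].
- exists (x - 1, y, z); last by rewrite zexpgP !mulgA.
  by split=> /=; [lia|lia|nia].
- exists (x, y - 1, z - x); last first.
    rewrite zexpa_hbV zexpgP zexpgD zexpgN.
    have cV : commute (zexpg hc z) (zexpg hc x)^-1%g by exact: cc.
    by rewrite cV !mulgA.
  by split=> /=; [lia|lia|nia].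
Qed.

End HeisCoordinates.

(** * Growth of balls *)

Section HeisVolume.

Definition zrange (n : nat) : seq int := [seq i%:Z - n%:Z | i <- iota 0 n.*2.+1].

Lemma mem_zrange (n : nat) (x : int) : `|x| <= n%:Z -> x \in zrange n.
Proof.
move=> xn; apply/mapP; exists (absz (x + n%:Z)); last by lia.
by rewrite mem_iota; lia.
Qed.

Lemma card_hball_le (n : nat) : (size (hball n) <= n.*2.+1 * n.*2.+1 * (n * n).*2.+1)%N.
Proof.
pose s := [seq normal_form (xy, z)
  | xy <- [seq (x, y) | x <- zrange n, y <- zrange n], z <- zrange (n * n)].
have <- : size s = (n.*2.+1 * n.*2.+1 * (n * n).*2.+1)%N.
  by rewrite /s !size_allpairs !size_map !size_iota.
apply: uniq_leq_size; first exact: hball_uniq.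
move=> g; rewrite mem_hball => /heis_ball_normal_form[[[x y] z] [/= bx by_ bz] ->].
apply: (allpairs_f (fun xy z => normal_form (xy, z))); last exact: mem_zrange.
by apply: (allpairs_f pair); exact: mem_zrange.
Qed.

Lemma card_hball_ge (r : nat) : (0 < r)%N -> (r * r * (r * r) <= size (hball (8 * r)))%N.
Proof.
move=> r0.
pose s := [seq normal_form (xy.1%:Z, xy.2%:Z, z%:Z)
  | xy <- [seq (x, y) | x <- iota 0 r, y <- iota 0 r], z <- iota 0 (r * r)].
have <- : size s = (r * r * (r * r))%N.
  by rewrite /s !size_allpairs !size_iota.
apply: uniq_leq_size.
  apply: allpairs_uniq; rewrite ?iota_uniq //.
    by apply: allpairs_uniq; rewrite ?iota_uniq // => -[? ?] [? ?].
  move=> [[x y] z] [[x' y'] z'] _ _ e.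
  by have [-> -> ->] := @normal_form_nat_inj (x, y, z) (x', y', z') e.
move=> g /allpairsP[[xy z] [/allpairsP[[x y] /= [hx hy ->]] /= hz ->]].
move: hx hy hz; rewrite !mem_iota !add0n /= => hx hy hz.
rewrite mem_hball; apply: (@heis_ball_le (y + x + 6 * r)); first by lia.
rewrite /normal_form /=.
apply: heis_ballM; last by apply: heis_ball_hcX => //; rewrite -mulnn ltnW.
by apply: heis_ballM; apply: heis_ballX; rewrite ?ha_gen ?hb_gen.
Qed.

Lemma card_hball_homo (m n : nat) : (m <= n)%N -> (size (hball m) <= size (hball n))%N.
Proof.
move=> mn; apply: uniq_leq_size; first exact: hball_uniq.
by move=> g; rewrite !mem_hball => /leq_trans; apply.
Qed.

(** Both cardinals are comparable with r^4; in the upper bound 2n + 1 <= 41r and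
    2n^2 + 1 <= 801r^2 for n = 20r. *)
Lemma card_hball_doubling (R : numDomainType) (r : nat) : (0 < r)%N ->
  (size (hball (20 * r)))%:R <= 41 * 41 * 801 * (size (hball (10 * r)))%:R :> R.
Proof.
move=> r0; rewrite -!natrM ler_nat.
apply: leq_trans (card_hball_le _) _.
apply: (@leq_trans (41 * 41 * 801 * (r * r * (r * r)))).
  rewrite (_ : (41 * 41 * 801 * (r * r * (r * r))
              = (41 * r) * (41 * r) * (801 * (r * r)))%N); last first.
    rewrite [RHS]mulnA [(41 * r * (41 * r))%N]mulnACA; lia.
  by apply: leq_mul; [apply: leq_mul|]; nia.
(* K is kept abstract: 41 * 41 * 801 is too large for unary computation. *)
move: (41 * 41 * 801)%N => K.
by apply: leq_mul => //; apply: leq_trans (card_hball_ge r0) (card_hball_homo _); lia.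
Qed.

End HeisVolume.

(** * The global inequality for finitely supported functions *)

Section FiniteSupport.
Variables (R : realType) (V : lmodType R).

Definition fin_supp : {pred heis -> V} :=
  fun u => `[< finite_set [set x | u x != 0] >].

Lemma fin_suppP (u : heis -> V) :
  reflect (finite_set [set x | u x != 0]) (u \in fin_supp).
Proof. exact: asboolP. Qed.

Lemma fin_supp_submod : submod_closed fin_supp.
Proof.
split; first by apply/fin_suppP; apply: sub_finite_set (finite_set0 _) => x /=; rewrite eqxx.
move=> a u v /fin_suppP fu /fin_suppP fv; apply/fin_suppP.
apply: (@sub_finite_set _ _ ([set x | u x != 0] `|` [set x | v x != 0])); last by rewrite finite_setU.
move=> x nz; have [ux|] := eqVneq (u x) 0; last by left.
have [vx|] := eqVneq (v x) 0; last by right.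
suff e : (a *: u + v) x = 0 by move: nz; rewrite /= e eqxx.
by rewrite -[LHS]/(a *: u x + v x) ux vx scaler0 addr0.
Qed.

HB.instance Definition _ :=
  GRing.isSubmodClosed.Build R (heis -> V) fin_supp fin_supp_submod.

Record fsfun_heis := FSFun { fsval :> heis -> V; _ : fsval \in fin_supp }.
HB.instance Definition _ := [isSub for fsval].
HB.instance Definition _ := [Choice of fsfun_heis by <:].
HB.instance Definition _ := [SubChoice_isSubLmodule of fsfun_heis by <:].

Lemma translate_fin_supp (g : heis) (u : fsfun_heis) :
  (fun x => u (x * g)%g) \in fin_supp.
Proof.
have /fin_suppP fu := valP u; apply/fin_suppP.
apply: (@sub_finite_set _ _ ((fun x => x * g^-1)%g @` [set x | u x != 0])); last exact: finite_image.
by move=> x /= ux; exists (x * g)%g => //; rewrite mulgK.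
Qed.

Definition translate (g : heis) (u : fsfun_heis) : fsfun_heis :=
  FSFun (translate_fin_supp g u).

Lemma fsfun_eq (u v : fsfun_heis) : (forall x, u x = v x) -> u = v.
Proof. by move=> uv; apply: val_inj; apply: funext. Qed.

Lemma translateB g u v : translate g (u - v) = translate g u - translate g v.
Proof. by apply: fsfun_eq. Qed.

Lemma translateM (g h : heis) (u : fsfun_heis) :
  translate g (translate h u) = translate (g * h)%g u.
Proof. by apply: fsfun_eq => x; rewrite -[RHS]/(u (x * (g * h))%g) mulgA. Qed.

Lemma fsfun_support (u : fsfun_heis) : finite_set [set x | u x != 0].
Proof. by have /fin_suppP := valP u. Qed.

Variable dot : V -> V -> R.
Hypothesis dotD : forall u v w, dot (u + v) w = dot u w + dot v w.
Hypothesis dotZ : forall a u w, dot (a *: u) w = a * dot u w.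
Hypothesis dotC : forall u v, dot u v = dot v u.
Hypothesis dot_ge0 : forall u, 0 <= dot u u.

Definition ip (u v : fsfun_heis) : R := \sum_(x \in [set: heis]) dot (u x) (v x).

Let dot0 w : dot 0 w = 0.
Proof. by rewrite -(scale0r 0) dotZ mul0r. Qed.

Let ip_restrict (A : set heis) (u v : fsfun_heis) :
  (forall x, ~ A x -> u x = 0) -> ip u v = \sum_(x \in A) dot (u x) (v x).
Proof.
move=> Au; rewrite /ip; apply/esym/fsbig_widen => //.
by move=> x /= [_ /Au ->].
Qed.

Lemma ipD u v w : ip (u + v) w = ip u w + ip v w.
Proof.
set A := [set x | u x != 0] `|` [set x | v x != 0].
have finA : finite_set A by rewrite finite_setU; split; exact: fsfun_support.
have uA x : ~ A x -> u x = 0 by move=> /not_orP[/negP + _]; rewrite negbK => /eqP.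
have vA x : ~ A x -> v x = 0 by move=> /not_orP[_ /negP]; rewrite negbK => /eqP.
rewrite !(@ip_restrict A) //.
  by rewrite -fsbig_split //; apply: eq_fsbigr => x _; rewrite dotD.
by move=> x Ax; rewrite -[LHS]/(u x + v x) uA // vA // addr0.
Qed.

Lemma ipZ a u w : ip (a *: u) w = a * ip u w.
Proof. by rewrite /ip mulr_fsumr; apply: eq_fsbigr => x _; rewrite dotZ. Qed.

Lemma ipC u v : ip u v = ip v u.
Proof. by apply: eq_fsbigr => x _; rewrite dotC. Qed.

Lemma ip_ge0 u : 0 <= ip u u.
Proof. exact: fsumr_ge0. Qed.

Lemma ip_translate g u v : ip (translate g u) (translate g v) = ip u v.
Proof.
rewrite /ip; apply/esym.
apply: (reindex_fsbigT (fun x => x * g)%g (fun x => dot (u x) (v x))).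
by exists (fun x => x * g^-1)%g => x; rewrite ?mulgK ?mulgVK.
Qed.

Lemma iter_translate g n u x : iter n (translate g) u x = u (x * g ^+ n)%g.
Proof.
elim: n x => [|n IH] x; first by rewrite expg0 mulg1.
by rewrite iterS -[LHS]/(iter n (translate g) u (x * g)%g) IH expgS mulgA.
Qed.

(** The center coordinate of x hc^j grows with j, so the translated support
    leaves any finite set. *)
Lemma ip_translate_hc_eventually u v :
  exists J, forall j, (J <= j)%N -> ip (iter j (translate hc) u) v = 0.
Proof.
pose ht x := absz (hcoord x).2.
have bound (w : fsfun_heis) : exists N, forall x, w x != 0 -> (ht x <= N)%N.
  exists (\max_(x <- fset_set [set x | w x != 0]) ht x) => x wx.
  by apply: leq_bigmax_seq => //; rewrite in_fset_set ?inE //; exact: fsfun_support.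
have [[Nu Hu] [Nv Hv]] := (bound u, bound v).
exists (Nu + Nv).+1 => j Jj; apply: fsbig1 => x _; rewrite iter_translate.
have [->|ux] := eqVneq (u (x * hc ^+ j)%g) 0; first exact: dot0.
have [->|vx] := eqVneq (v x) 0; first by rewrite dotC dot0.
move: (Hu _ ux) (Hv _ vx); rewrite /ht hcoordM hcoord_expc /= mulr0 addr0.
lia.
Qed.

Lemma sum_translate_hc_le (u : fsfun_heis) K :
  \sum_(1 <= k < K) ip (iter k (translate hc) u - u) (iter k (translate hc) u - u) / k%:R ^+ 2
   <= 29 * (ip (translate ha u - u) (translate ha u - u)
            + ip (translate hb u - u) (translate hb u - u)).
Proof.
apply: (commutator_energy_le ipD ipZ ipC ip_ge0).
- exact: ip_translate.
- exact: ip_translate_hc_eventually.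
- exact: translateB.
- exact: ip_translate.
- exact: ip_translate.
- exact: translateB.
- exact: translateB.
- by move=> w; rewrite !translateM hc_central.
- by move=> w; rewrite !translateM hc_central.
- by move=> w; rewrite !translateM ha_hb -hc_central mulgA.
Qed.

End FiniteSupport.

(** * The Poincare inequality on balls *)

Section Summation.

(** How translated sums are compared with sums over balls: a translation is
    injective, and it is used only where it lands in the target ball. *)
Lemma sum_inj_le (R : numDomainType) (S T : eqType) (s : seq S) (t : seq T)
    (h : S -> T) (F : T -> R) :
  uniq s -> uniq t -> injective h -> (forall z, 0 <= F z) ->
  \sum_(x <- s | h x \in t) F (h x) <= \sum_(z <- t) F z.
Proof.
move=> us ut hi F0; pose s' := [seq h x | x <- s & h x \in t].
have -> : \sum_(x <- s | h x \in t) F (h x) = \sum_(z <- s') F z.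
  by rewrite /s' big_map big_filter.
have us' : uniq s' by rewrite map_inj_uniq // filter_uniq.
have : perm_eq s' [seq z <- t | z \in s'].
  apply: uniq_perm => //; first exact: filter_uniq.
  move=> z; rewrite mem_filter; case: (boolP (z \in s')) => //= /mapP[x + ->].
  by rewrite mem_filter => /andP[-> _].
move=> pe; rewrite (perm_big _ pe) big_filter big_mkcond; apply: ler_sum => z _.
by case: ifP.
Qed.

Lemma sqr_sum_le (R : realDomainType) (n : nat) (a : 'I_n -> R) :
  (\sum_i a i) ^+ 2 <= n%:R * \sum_i a i ^+ 2.
Proof.
rewrite -subr_ge0 -(pmulr_rge0 _ (ltr0n _ 2)).
have -> : 2%:R * (n%:R * \sum_i a i ^+ 2 - (\sum_i a i) ^+ 2)
    = \sum_i \sum_j (a i - a j) ^+ 2.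
  have -> : \sum_i \sum_j (a i - a j) ^+ 2
     = \sum_(i < n) (n%:R * a i ^+ 2 - 2%:R * (\sum_j a j) * a i + \sum_j a j ^+ 2).
    apply: eq_bigr => i _.
    rewrite (eq_bigr (fun j => a i ^+ 2 - 2%:R * a i * a j + a j ^+ 2)); last first.
      by move=> j _; ring.
    rewrite big_split sumrB /= sumr_const card_ord -[_ *+ n]mulr_natl -mulr_sumr.
    by ring.
  rewrite big_split sumrB /= sumr_const card_ord -!mulr_sumr -[_ *+ n]mulr_natl.
  ring.
by apply: sumr_ge0 => i _; apply: sumr_ge0 => j _; exact: sqr_ge0.
Qed.

Lemma sqr_norm_path_le (R : realType) (V : normedModType R) (u : nat -> V) (n : nat) :
  `|u n - u 0%N| ^+ 2 <= n%:R * \sum_(i < n) `|u i.+1 - u i| ^+ 2.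
Proof.
rewrite -(telescope_sumr _ (leq0n n)) big_mkord.
apply: le_trans (sqr_sum_le _); rewrite ler_pXn2r ?nnegrE //.
  exact: ler_norm_sum.
by apply: sumr_ge0.
Qed.

End Summation.

Section Localization.
Variables (R : realType) (V : normedModType R).

Variable f : heis -> V.

Definition grad2 (x : heis) : R :=
  `|f (x * ha)%g - f x| ^+ 2 + `|f (x * hb)%g - f x| ^+ 2.

Lemma grad2_ge0 x : 0 <= grad2 x.
Proof. by rewrite addr_ge0. Qed.

(** An edge labelled by an inverse generator is read backwards, from its end
    point, so that its increment is one of those in [grad2]. *)
Definition edge_base (s : heis) : heis := if s \in [:: ha; hb] then 1%g else s.

Lemma sqr_edge_le (x s : heis) : s \in heis_gens ->
  `|f (x * s)%g - f x| ^+ 2 <= grad2 (x * edge_base s)%g.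
Proof.
move=> sS; rewrite /edge_base; case: ifP.
  rewrite mulg1 !inE => /orP[] /eqP ->; rewrite /grad2.
    by rewrite lerDl.
  by rewrite lerDr.
move: sS; rewrite !inE => /or4P[] /eqP ->; rewrite ?eqxx ?orbT // => _.
  by rewrite /grad2 mulgVK distrC lerDl.
by rewrite /grad2 mulgVK distrC lerDr.
Qed.

(** A point of the path is at distance at most half the length of the path from
    one of its two end points. *)
Lemma path_in_hball (rho : nat) (x : heis) (v w : seq heis) :
  {subset v ++ w <= heis_gens} -> (size (v ++ w) <= 2 * rho)%N ->
  (hlen x <= rho)%N -> (hlen (x * heis_prod (v ++ w))%g <= rho)%N ->
  (hlen (x * heis_prod v)%g <= 2 * rho)%N.
Proof.
move=> vwS sz xr xwr.
have vS : {subset v <= heis_gens} by move=> s sv; apply: vwS; rewrite mem_cat sv.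
have wS : {subset w <= heis_gens} by move=> s sw; apply: vwS; rewrite mem_cat sw orbT.
have h1 : (hlen (x * heis_prod v)%g <= rho + size v)%N.
  by apply: leq_trans (hlenM _ _) _; rewrite leq_add // hlen_prod.
have h2 : (hlen (x * heis_prod v)%g <= rho + size w)%N.
  have -> : (x * heis_prod v = x * heis_prod (v ++ w) * (heis_prod w)^-1)%g.
    by rewrite heis_prod_cat mulgA mulgK.
  apply: leq_trans (hlenM _ _) _; rewrite leq_add //.
  by apply: leq_trans (hlenV _) _; rewrite hlen_prod.
by move: sz; rewrite size_cat; lia.
Qed.

(** Cauchy-Schwarz along a word for g, then summation over the starting
    point x: for each of the at most 2 rho steps, the base point of the edge is a
    right translate of x, so each step contributes at most one full sum of
    [grad2]. *)
Lemma sum_increment_le (rho : nat) (g : heis) : (hlen g <= 2 * rho)%N ->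
  \sum_(x <- hball rho | (x * g)%g \in hball rho) `|f (x * g)%g - f x| ^+ 2
   <= (2 * rho)%:R ^+ 2 * \sum_(z <- hball (2 * rho)) grad2 z.
Proof.
move=> gr; have /heis_ballP[w [wS sw wg]] := gr.
pose p i := heis_prod (take i w).
have pS i : (i < size w)%N -> p i.+1 = (p i * nth 1 w i)%g.
  move=> iw; rewrite /p (take_nth 1%g) // -cats1 heis_prod_cat heis_prod_cons.
  by rewrite {2}/heis_prod big_nil mulg1.
have p0 : p 0%N = 1%g by rewrite /p take0 /heis_prod big_nil.
have pn : p (size w) = g by rewrite /p take_size.
have E0 : 0 <= \sum_(z <- hball (2 * rho)) grad2 z.
  by apply: sumr_ge0 => z _; exact: grad2_ge0.
pose q i := (p i * edge_base (nth 1 w i))%g.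
apply: (@le_trans _ _ (\sum_(x <- hball rho | (x * g)%g \in hball rho)
   (size w)%:R * \sum_(i < size w)
      if (x * q i)%g \in hball (2 * rho) then grad2 (x * q i)%g else 0)).
  rewrite big_seq_cond [leRHS]big_seq_cond; apply: ler_sum => x /andP[].
  rewrite !mem_hball => xr xgr.
  have := sqr_norm_path_le (fun i => f (x * p i)%g) (size w).
  rewrite /= pn p0 mulg1 => /le_trans; apply.
  apply: ler_wpM2l => //; apply: ler_sum => i _.
  have inb j : (hlen (x * p j)%g <= 2 * rho)%N.
    by apply: (path_in_hball (w := drop j w)) => //; rewrite cat_take_drop ?wg.
  rewrite pS // mulgA mem_hball.
  have -> : (hlen (x * q i)%g <= 2 * rho)%N.
    rewrite /q /edge_base; case: ifP => _; first by rewrite mulg1.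
    by rewrite -pS.
  by rewrite /q mulgA; apply: sqr_edge_le; apply: wS; rewrite mem_nth.
rewrite -mulr_sumr exchange_big /=.
apply: (@le_trans _ _ ((size w)%:R * \sum_(i < size w) \sum_(z <- hball (2 * rho)) grad2 z)).
  apply: ler_wpM2l => //; apply: ler_sum => i _.
  apply: le_trans (@sum_inj_le R _ _ (hball rho) _ (fun x => x * q i)%g grad2 _ _ _ _).
  - rewrite big_mkcond [leRHS]big_mkcond; apply: ler_sum => x _.
    by case: ifP => // _; case: ifP => // _; exact: grad2_ge0.
  - exact: hball_uniq.
  - exact: hball_uniq.
  - exact: mulIg.
  - exact: grad2_ge0.
rewrite sumr_const card_ord -[X in _ * X]mulr_natl mulrA -expr2 ler_wpM2r //.
by rewrite ler_pXn2r ?nnegrE // ler_nat.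
Qed.

(** Substituting y = x g, with g = x^-1 y in the ball of radius 2 rho, reduces to
    [sum_increment_le] for each g. *)
Lemma poincare (rho : nat) :
  \sum_(x <- hball rho) \sum_(y <- hball rho) `|f y - f x| ^+ 2
   <= (size (hball (2 * rho)))%:R * ((2 * rho)%:R ^+ 2 * \sum_(z <- hball (2 * rho)) grad2 z).
Proof.
apply: (@le_trans _ _ (\sum_(x <- hball rho) \sum_(g <- hball (2 * rho))
    if (x * g)%g \in hball rho then `|f (x * g)%g - f x| ^+ 2 else 0)).
  rewrite big_seq [leRHS]big_seq; apply: ler_sum => x; rewrite mem_hball => xr.
  pose F g := if (x * g)%g \in hball rho then `|f (x * g)%g - f x| ^+ 2 else 0.
  apply: le_trans (@sum_inj_le R _ _ (hball rho) _ (fun y => x^-1 * y)%g F _ _ _ _).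
  - rewrite big_seq [leRHS]big_seq_cond; rewrite big_mkcond [leRHS]big_mkcond.
    apply: ler_sum => y _; case: (boolP (y \in _)) => //= yr.
    rewrite mem_hball /F mulVKg yr.
    move: yr; rewrite mem_hball => yr.
    suff -> : (hlen (x^-1 * y)%g <= 2 * rho)%N by [].
    apply: leq_trans (hlenM _ _) _; have := hlenV x; lia.
  - exact: hball_uniq.
  - exact: hball_uniq.
  - exact: mulgI.
  - by move=> g; rewrite /F; case: ifP.
rewrite exchange_big /=.
apply: (@le_trans _ _ (\sum_(g <- hball (2 * rho))
   ((2 * rho)%:R ^+ 2 * \sum_(z <- hball (2 * rho)) grad2 z))).
  rewrite big_seq [leRHS]big_seq; apply: ler_sum => g; rewrite mem_hball => gr.
  by rewrite -big_mkcond; exact: sum_increment_le.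
by rewrite big_const_seq count_predT iter_addr_0 -[leLHS]mulr_natl.
Qed.

End Localization.

(** * Localization *)

Section Cutoff.
Variables (R : realType) (V : normedModType R) (dot : V -> V -> R).
Hypothesis dotD : forall u v w, dot (u + v) w = dot u w + dot v w.
Hypothesis dotZ : forall a u w, dot (a *: u) w = a * dot u w.
Hypothesis dotC : forall u v, dot u v = dot v u.
Hypothesis dot_norm : forall v, `|v| ^+ 2 = dot v v.

Let dot_ge0 v : 0 <= dot v v.
Proof. by rewrite -dot_norm. Qed.

Let ip_norm (w : fsfun_heis V) : ip dot w w = \sum_(x \in [set: heis]) `|w x| ^+ 2.
Proof. by apply: eq_fsbigr => x _; rewrite dot_norm. Qed.

Lemma sum_le_ip (w : fsfun_heis V) n :
  \sum_(x <- hball n) `|w x| ^+ 2 <= ip dot w w.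
Proof.
pose A := (fset_set (heis_ball n) `|` fset_set [set x | w x != 0])%fset.
have finw := fsfun_support w.
rewrite ip_norm (@fsbigTE _ _ _ _ A); last first.
  move=> x; rewrite in_fsetU negb_or => /andP[_]; rewrite in_fset_set //.
  by rewrite notin_setE /= => /negP; rewrite negbK => /eqP ->; rewrite normr0 expr0n.
apply: le_trans (@sum_inj_le R _ _ (hball n) A id (fun x => `|w x| ^+ 2) _ _ _ _) => //.
- rewrite [leLHS]big_seq [leLHS]big_mkcond [leRHS]big_mkcond; apply: ler_sum => x _.
  case: ifP => xn; last by case: ifP.
  by rewrite in_fsetU xn.
- exact: hball_uniq.
Qed.

Lemma ip_le_sum (w : fsfun_heis V) n (G : heis -> R) :
  (forall x, (n < hlen x)%N -> w x = 0) ->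
  (forall x, (hlen x <= n)%N -> `|w x| ^+ 2 <= G x) ->
  ip dot w w <= \sum_(x <- hball n) G x.
Proof.
move=> w0 wG; rewrite ip_norm (@fsbigTE _ _ _ _ (fset_set (heis_ball n))).
  rewrite big_seq [leRHS]big_seq; apply: ler_sum => x; rewrite mem_hball; exact: wG.
move=> x; rewrite -[_ \in _]/(x \in hball n) mem_hball -ltnNge => /w0 ->.
by rewrite normr0 expr0n.
Qed.

Variables (f : heis -> V) (r : nat).
Hypothesis r_gt0 : (0 < r)%N.

(** With integer values: r times the usual cutoff, so that its increments are at
    most 1. *)
Definition cutoff (x : heis) : nat := minn r (10 * r - hlen x).

Lemma cutoff_step (x s : heis) : s \in heis_gens ->
  `|(cutoff (x * s)%g)%:R - (cutoff x)%:R : R| <= 1.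
Proof.
move=> sS; have s1 : (hlen s <= 1)%N := heis_ball_gen sS.
have h1 : (hlen (x * s)%g <= hlen x + hlen s)%N := hlenM _ _.
have h2 : (hlen x <= hlen (x * s)%g + hlen s)%N.
  rewrite -{1}(mulgK s x); apply: leq_trans (hlenM _ _) _.
  by rewrite leq_add2l hlenV.
have h3 : (cutoff (x * s)%g <= (cutoff x).+1)%N by rewrite /cutoff; lia.
have h4 : (cutoff x <= (cutoff (x * s)%g).+1)%N by rewrite /cutoff; lia.
move: h3 h4; rewrite -!(ler_nat R) -!natr1 => h3 h4.
by rewrite ler_norml; apply/andP; split; lra.
Qed.

Lemma cutoff_le (x : heis) : (cutoff x)%:R <= r%:R :> R.
Proof. by rewrite ler_nat geq_minl. Qed.

Lemma cutoff_inner (x : heis) : (hlen x <= 9 * r)%N -> cutoff x = r.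
Proof. by rewrite /cutoff; lia. Qed.

Lemma cutoff_outer (x : heis) : (10 * r <= hlen x)%N -> cutoff x = 0%N.
Proof. by rewrite /cutoff; lia. Qed.

Lemma localize_fin_supp (y : heis) :
  (fun x => (cutoff x)%:R *: (f x - f y)) \in @fin_supp R V.
Proof.
apply/fin_suppP; apply: sub_finite_set (finite_heis_ball (10 * r)) => x /=.
move=> nz; rewrite /heis_ball /= leqNgt; apply/negP => far.
by move: nz; rewrite cutoff_outer ?scale0r ?eqxx // ltnW.
Qed.

Definition localize (y : heis) : fsfun_heis V := FSFun (localize_fin_supp y).

(** The discrete Leibniz rule; the cutoff is at most r and its increments are at
    most 1. *)
Lemma localize_increment_le (y s : heis) (G : heis -> R) : s \in heis_gens ->
  (forall x, `|f (x * s)%g - f x| ^+ 2 <= G x) ->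
  ip dot (translate s (localize y) - localize y) (translate s (localize y) - localize y)
  <= \sum_(x <- hball (10 * r)) (2 * r%:R ^+ 2 * G x + 2 * `|f x - f y| ^+ 2).
Proof.
move=> sS sG; apply: ip_le_sum => x.
  move=> xr; have s1 : (hlen s <= 1)%N := heis_ball_gen sS.
  have h2 : (hlen x <= hlen (x * s)%g + hlen s)%N.
    rewrite -{1}(mulgK s x); apply: leq_trans (hlenM _ _) _.
    by rewrite leq_add2l hlenV.
  rewrite -[LHS]/((cutoff (x * s)%g)%:R *: (f (x * s)%g - f y) - (cutoff x)%:R *: (f x - f y)).
  rewrite (@cutoff_outer x) ?(@cutoff_outer (x * s)%g) ?scale0r ?subrr //; lia.
move=> xr; rewrite -[X in `|X|]/((cutoff (x * s)%g)%:R *: (f (x * s)%g - f y)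
  - (cutoff x)%:R *: (f x - f y)).
set m' : R := (cutoff (x * s)%g)%:R; set m : R := (cutoff x)%:R.
have -> : m' *: (f (x * s)%g - f y) - m *: (f x - f y)
    = m' *: (f (x * s)%g - f x) + (m' - m) *: (f x - f y).
  by rewrite scalerBl addrA -scalerDr addrA subrK.
apply: (@le_trans _ _ ((m' * `|f (x * s)%g - f x| + `|m' - m| * `|f x - f y|) ^+ 2)).
  rewrite ler_pXn2r ?nnegrE ?addr_ge0 ?mulr_ge0 //.
  by apply: le_trans (ler_normD _ _) _; rewrite !normrZ ger0_norm.
apply: le_trans (_ : 2 * (m' * `|f (x * s)%g - f x|) ^+ 2
  + 2 * (`|m' - m| * `|f x - f y|) ^+ 2 <= _).
  set p := m' * _; set q := `|m' - m| * _.
  have := sqr_ge0 (p - q); nra.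
have m'r : m' <= r%:R := cutoff_le _.
have m1 : `|m' - m| <= 1 := cutoff_step _ sS.
rewrite !exprMn -[2 * _ * G x]mulrA; apply: lerD; rewrite ler_pM2l //.
  apply: ler_pM; [exact: sqr_ge0|exact: sqr_ge0| |exact: sG].
  by rewrite ler_pXn2r ?nnegrE.
by rewrite ler_piMl ?exprn_ge0 // expr_le1.
Qed.

(** On the ball of radius r the points x and x hc^k lie where the cutoff equals
    r, so the increments of the localized function are r times those of f. *)
Lemma center_increment_le (y : heis) :
  r%:R ^+ 2 * (\sum_(x <- hball r) \sum_(1 <= k < (r ^ 2).+1%N)
          `|f (x * hc ^+ k)%g - f x| ^+ 2 / k%:R ^+ 2)
  <= 29 * (\sum_(x <- hball (10 * r)) (2 * r%:R ^+ 2 * grad2 f x)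
     + \sum_(x <- hball (10 * r)) 4 * `|f x - f y| ^+ 2).
Proof.
have key := sum_translate_hc_le dotD dotZ dotC dot_ge0 (localize y) (r ^ 2).+1.
apply: le_trans (le_trans _ key) _.
  rewrite exchange_big /= mulr_sumr; apply: ler_sum_nat => k /andP[k0 kr].
  rewrite -mulr_suml mulrA ler_wpM2r ?invr_ge0 ?exprn_ge0 //.
  apply: le_trans (sum_le_ip _ r).
  rewrite mulr_sumr big_seq [leRHS]big_seq; apply: ler_sum => x.
  rewrite mem_hball => xr.
  have ck : (hlen (hc ^+ k)%g <= 6 * r)%N by apply: heis_ball_hcX => //; rewrite -ltnS.
  have xck : (hlen (x * hc ^+ k)%g <= 9 * r)%N.
    apply: leq_trans (hlenM _ _) _; apply: leq_trans (leq_add xr ck) _.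
    by rewrite -mulSn leq_mul2r orbT.
  rewrite -[X in _ <= `|X| ^+ 2]/(iter k (translate hc) (localize y) x - localize y x).
  rewrite iter_translate /=.
  have x9r : (hlen x <= 9 * r)%N by apply: leq_trans xr _; rewrite leq_pmull.
  rewrite (cutoff_inner xck) (cutoff_inner x9r).
  rewrite -scalerBr opprB addrA subrK normrZ exprMn.
  by rewrite ger0_norm.
rewrite ler_pM2l // -big_split /=.
pose Ga x := `|f (x * ha)%g - f x| ^+ 2.
pose Gb x := `|f (x * hb)%g - f x| ^+ 2.
have ea := @localize_increment_le y ha Ga ha_gen (fun=> lexx _).
have eb := @localize_increment_le y hb Gb hb_gen (fun=> lexx _).
apply: le_trans (lerD ea eb) _; rewrite -big_split /=.
apply: ler_sum => x _; rewrite /grad2 -/(Ga x) -/(Gb x); lra.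
Qed.

(** Sum [center_increment_le] over the base points y in the ball of radius 10r
    and absorb the double sum by [poincare]: 1600 = 4 * 20^2 comes from paths of
    length 20r, and 41 * 41 * 801 from doubling. *)
Lemma local_inequality :
  \sum_(x <- hball r) \sum_(1 <= k < (r ^ 2).+1%N)
          `|f (x * hc ^+ k)%g - f x| ^+ 2 / k%:R ^+ 2
  <= (29 * (2 + 1600 * (41 * 41 * 801))) * \sum_(x <- hball (22 * r)) grad2 f x.
Proof.
set L := \sum_(x <- hball r) _; set E := \sum_(x <- hball (22 * r)) _.
have mono n : (n <= 22 * r)%N -> \sum_(x <- hball n) grad2 f x <= E.
  move=> nr; apply: le_trans (@sum_inj_le R _ _ (hball n) (hball (22 * r)) id (grad2 f) _ _ _ _).
  - rewrite [leLHS]big_seq [leLHS]big_mkcond [leRHS]big_mkcond; apply: ler_sum => x _.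
    rewrite !mem_hball; case: ifP => [xn|_]; last by case: ifP => // _; exact: grad2_ge0.
    by rewrite (leq_trans xn nr).
  - exact: hball_uniq.
  - exact: hball_uniq.
  - by move=> ?.
  - exact: grad2_ge0.
pose v : R := (size (hball (10 * r)))%:R.
have E0 : 0 <= E by apply: sumr_ge0 => x _; exact: grad2_ge0.
have rR : 0 < r%:R :> R by rewrite ltr0n.
have v0 : 0 < v.
  have r8 : (8 * r <= 10 * r)%N by rewrite leq_mul2r orbT.
  rewrite ltr0n; apply: leq_trans (card_hball_homo r8).
  by apply: leq_trans (card_hball_ge r_gt0); rewrite !muln_gt0 r_gt0.
have avg : v * (r%:R ^+ 2 * L) <= 29 * (v * (2 * r%:R ^+ 2 * E)
    + 4 * \sum_(y <- hball (10 * r)) \sum_(x <- hball (10 * r)) `|f x - f y| ^+ 2).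
  have cst (c : R) : v * c = \sum_(y <- hball (10 * r)) c.
    by rewrite big_const_seq count_predT iter_addr_0 -[RHS]mulr_natl.
  rewrite !cst [4 * _]mulr_sumr -big_split /= [leRHS]mulr_sumr; apply: ler_sum => y _.
  apply: le_trans (center_increment_le y) _; rewrite ler_pM2l //.
  rewrite -!mulr_sumr lerD2r ler_pM2l; first by apply: mono; rewrite leq_mul2r orbT.
  by rewrite mulr_gt0 // exprn_gt0.
have poinc := poincare f (10 * r).
have vol := card_hball_doubling R r_gt0.
have e20 : (2 * (10 * r) = 20 * r)%N by rewrite mulnA.
rewrite e20 in poinc.
have E20 : \sum_(z <- hball (20 * r)) grad2 f z <= E by apply: mono; rewrite leq_mul2r orbT.
have poinc' : \sum_(y <- hball (10 * r)) \sum_(x <- hball (10 * r)) `|f x - f y| ^+ 2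
    <= (41 * 41 * 801 * v) * ((20 * r)%:R ^+ 2 * E).
  apply: le_trans poinc _; apply: ler_pM => //.
    by rewrite mulr_ge0 ?exprn_ge0 // sumr_ge0 // => z _; exact: grad2_ge0.
  by rewrite ler_wpM2l ?exprn_ge0.
have vr0 : 0 < v * r%:R ^+ 2 by rewrite mulr_gt0 ?exprn_gt0.
rewrite -(ler_pM2l vr0) -[leLHS]mulrA.
apply: le_trans avg _.
rewrite natrM in poinc'; move: poinc'.
set S := \sum_(y <- _) _; move=> poinc'.
apply: (@le_trans _ _ (29 * (v * (2 * r%:R ^+ 2 * E)
  + 4 * (41 * 41 * 801 * v * ((20 * r%:R) ^+ 2 * E))))).
  by rewrite ler_pM2l // lerD2l ler_pM2l.
rewrite le_eqVlt; apply/orP; left; apply/eqP.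
by move: (41 * 41 * 801 : R) => K; ring.
Qed.

End Cutoff.

Theorem theorem1p4 (R : realType) :
  exists A : R, 0 < A /\
    forall (V : completeNormedModType R) (dot : {dot V for idfun}),
      (forall v : V, `|v| ^+ 2 = dot v v) ->
    forall (f : heis -> V) (r : nat), (0 < r)%N ->
      \sum_(x \in heis_ball r) \sum_(1 <= k < (r ^ 2).+1%N)
          `|f (x * hc ^+ k)%g - f x| ^+ 2 / k%:R ^+ 2
      <= A * \sum_(x \in heis_ball (22 * r)%N)
          (`|f (x * ha)%g - f x| ^+ 2 + `|f (x * hb)%g - f x| ^+ 2).
Proof.
exists (29 * (2 + 1600 * (41 * 41 * 801))); split; first lra.
move=> V dot dot_norm f r r_gt0.
have dotD u v w : dot (u + v) w = dot u w + dot v w by exact: linearDl.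
have dotZ a u w : dot (a *: u) w = a * dot u w by exact: linearZl_LR.
have dotC u v : dot u v = dot v u by rewrite hermC expr0 mul1r.
rewrite !fsbig_finite; try exact: finite_heis_ball.
exact: (local_inequality dotD dotZ dotC dot_norm f r_gt0).
Qed.
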